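(* Let $n\ge 1$ and let $U\subset\mathbb{R}^{n+1}$ be a bounded open convex domain whose boundary $\partial U$ is a $C^3$ hypersurface with positive (Euclidean) normal curvatures. Fix $o\in U$ and, for $t>0$, let $S_t^n=\{p\in U: d_U(o,p)=t\}$ be the metric sphere of radius $t$ centered at $o$ in the Hilbert geometry $(U,d_U)$. Then $$\lim_{t\to\infty}\frac{\ln\big(\mathbf{Vol}(S_t^n)\big)}{t}=n .$$
   Context: Hilbert distance: for distinct $p,q\in U$, let $p_1$ and $q_1$ be the intersection points with $\partial U$ of the half-lines $p+\mathbb{R}_{-}(q-p)$ and $p+\mathbb{R}_{+}(q-p)$ respectively; then $d_U(p,q)=\frac12\ln\Big(\frac{\|q-q_1\|}{\|q-p_1\|}\cdot\frac{\|p-p_1\|}{\|p-q_1\|}\Big)$ and $d_U(p,p)=0$, where $\|\cdot\|$ is the Euclidean norm. This is a complete metric on $U$. $\mathbf{Vol}(S_t^n)$ denotes the $n$-dimensional Hausdorff measure of $S_t^n$ with respect to $d_U$, normalized as $\nu_n(A)=\lim_{r\to0}\mathbf{Vol}_E(\mathbb{B}^n)\inf\{\sum_i\rho_i^n: 2\rho_i<r,\ A\subseteq\bigcup_i B[x_i,\rho_i],\ x_i\in A\}$, where $B[x,\rho]$ is the closed $d_U$-ball and $\mathbb{B}^n$ the Euclidean unit ball of $\mathbb{R}^n$.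
   Formalization: The printed Hilbert distance formula is negative for all distinct p, q, so it is not a metric and every S_t with t > 0 would be empty; the ratio inside the logarithm is inverted to give the standard positive Hilbert distance. *)

(* Defs.v *)
From mathcomp Require Import ssreflect ssrfun ssrbool eqtype ssrnat fintype bigop.
From Stdlib Require Import Reals.
Open Scope R_scope.

Definition pt (N : nat) := 'I_N -> R.

Definition vadd {N} (x y : pt N) : pt N := fun i => x i + y i.
Definition vsub {N} (x y : pt N) : pt N := fun i => x i - y i.
Definition vscale {N} (a : R) (x : pt N) : pt N := fun i => a * x i.
Definition dot {N} (x y : pt N) : R := \big[Rplus/0]_(i < N) (x i * y i).
Definition enorm {N} (x : pt N) : R := sqrt (dot x x).
Definition basis {N} (i : 'I_N) : pt N := fun j => if j == i then 1 else 0.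

Definition eball {N} (x : pt N) (r : R) (y : pt N) : Prop := enorm (vsub y x) < r.
Definition is_open {N} (U : pt N -> Prop) : Prop :=
  forall x, U x -> exists r, 0 < r /\ forall y, eball x r y -> U y.
Definition is_bounded {N} (U : pt N -> Prop) : Prop :=
  exists M, forall x, U x -> enorm x <= M.
Definition is_convex {N} (U : pt N -> Prop) : Prop :=
  forall x y s, U x -> U y -> 0 <= s <= 1 ->
    U (vadd (vscale (1 - s) x) (vscale s y)).
Definition closure {N} (U : pt N -> Prop) (x : pt N) : Prop :=
  forall eps, 0 < eps -> exists y, U y /\ enorm (vsub y x) < eps.
Definition bdry {N} (U : pt N -> Prop) (x : pt N) : Prop := closure U x /\ ~ U x.

Definition has_partial {N} (f : pt N -> R) (i : 'I_N) (x : pt N) (l : R) : Prop :=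
  derivable_pt_lim (fun h => f (vadd x (vscale h (basis i)))) 0 l.
Definition cont_on {N} (f : pt N -> R) (W : pt N -> Prop) : Prop :=
  forall x, W x -> forall eps, 0 < eps -> exists delta, 0 < delta /\
    forall y, enorm (vsub y x) < delta -> Rabs (f y - f x) < eps.
Fixpoint Ck {N} (k : nat) (f : pt N -> R) (W : pt N -> Prop) : Prop :=
  match k with
  | O => cont_on f W
  | S k' => cont_on f W /\ exists g : 'I_N -> pt N -> R,
       (forall i x, W x -> has_partial f i x (g i x)) /\ (forall i, Ck k' (g i) W)
  end.

(* Boundary is a C^3 hypersurface with positive normal curvatures: locally
   U = {F < 0}, dU = {F = 0}, F of class C^3 with nonvanishing gradient, and
   the Hessian of F is positive definite on the tangent space (orthogonal
   complement of grad F), i.e. the second fundamental form w.r.t. the outward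
   normal grad F / |grad F| is positive definite. *)
Definition C3_pos_curv_boundary {N} (U : pt N -> Prop) : Prop :=
  forall x0, bdry U x0 -> exists r, 0 < r /\ exists F : pt N -> R,
    Ck 3 F (eball x0 r) /\
    (forall x, eball x0 r x -> (U x <-> F x < 0)) /\
    (forall x, eball x0 r x -> (bdry U x <-> F x = 0)) /\
    forall g : 'I_N -> pt N -> R,
      (forall i y, eball x0 r y -> has_partial F i y (g i y)) ->
      (forall x, eball x0 r x -> exists i, g i x <> 0) /\
      (forall x, eball x0 r x -> bdry U x ->
        forall v : pt N, (exists i, v i <> 0) -> dot (fun i => g i x) v = 0 ->
        forall H : 'I_N -> 'I_N -> R,
          (forall i j, has_partial (g i) j x (H i j)) ->
          \big[Rplus/0]_(i < N) \big[Rplus/0]_(j < N) (H i j * v i * v j) > 0).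

Definition hdist {N} (U : pt N -> Prop) (p q : pt N) (d : R) : Prop :=
  (p = q /\ d = 0) \/
  (p <> q /\ exists s1 s2 : R, s1 <= 0 /\ 0 <= s2 /\
     let p1 := vadd p (vscale s1 (vsub q p)) in
     let q1 := vadd p (vscale s2 (vsub q p)) in
     bdry U p1 /\ bdry U q1 /\
     d = / 2 * ln ((enorm (vsub q p1) * enorm (vsub p q1)) /
                   (enorm (vsub q q1) * enorm (vsub p p1)))).

Definition hball {N} (U : pt N -> Prop) (x : pt N) (rho : R) (y : pt N) : Prop :=
  U y /\ exists d, hdist U x y d /\ d <= rho.

Definition hsphere {N} (U : pt N -> Prop) (o : pt N) (t : R) (p : pt N) : Prop :=
  U p /\ hdist U o p t.

Fixpoint unit_ball_vol (k : nat) : R :=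
  match k with
  | O => 1
  | S O => 2
  | S (S k' as k1) => 2 * PI / INR (S k1) * unit_ball_vol k'
  end.

Definition adm_sums {N} (U : pt N -> Prop) (k : nat) (A : pt N -> Prop) (r : R)
  (s : R) : Prop :=
  exists (x : nat -> pt N) (rho : nat -> R),
    (forall i, 0 <= rho i /\ 2 * rho i < r) /\
    (forall i, A (x i)) /\
    (forall y, A y -> exists i, hball U (x i) (rho i) y) /\
    infinite_sum (fun i => rho i ^ k) s.

Definition is_inf (S : R -> Prop) (m : R) : Prop :=
  (forall s, S s -> m <= s) /\ (forall m', (forall s, S s -> m' <= s) -> m' <= m).

(* hmeasure U k A v : the k-dimensional Hausdorff measure of A w.r.t. d_U is
   the (finite) real number v. *)
Definition hmeasure {N} (U : pt N -> Prop) (k : nat) (A : pt N -> Prop) (v : R) : Prop :=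
  forall eps, 0 < eps -> exists delta, 0 < delta /\ forall r, 0 < r < delta ->
    exists I, is_inf (adm_sums U k A r) I /\ Rabs (unit_ball_vol k * I - v) < eps.

(* Main.v *)
Require Import Defs.
From HB Require Import structures.
From mathcomp Require Import ssreflect ssrfun ssrbool eqtype ssrnat seq choice fintype finfun bigop.
From Stdlib Require Import Reals Lra Psatz FunctionalExtensionality ClassicalEpsilon Classical.
Open Scope R_scope.

(** Let [g] be the gauge of [U] at [o] and [e = exp (- t)].  The sphere [S_t] is
    the level set [g p + e^2 g (- p) = 1 - e^2], a radial graph at depth of order
    [e^2] below the boundary.  By compactness and the C^2 bounds, balls of a fixed
    radius roll inside [U]; near a boundary point the positive curvature gives
    balls of a fixed radius enclosing [U].  A chord through a point of depth
    [e^2] and tangent to the sphere therefore has half-lengths of order [e].  The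
    inner balls give [d_U p q <= C |p - q| / e] for close points of [S_t], and a
    net of [O (m^n)] points of mesh [O (1/m)] yields the upper bound [O (e^-n)] on
    the measure.  The outer balls give [|p - q| <= C e d_U p q], so a cover of
    [S_t] by Hilbert balls of radii [rho_i] induces, by central projection, a
    cover of a fixed [n]-cube by sets of diameter [O (e rho_i)]; counting grid
    points gives the lower bound [c e^-n]. *)

(** * Euclidean space *)

(** Only the order of growth matters: a factor independent of t adds O(1) to the logarithm and
    vanishes after division by t, so constants are crude throughout. The depth e^2 comes from the
    cross-ratio on the line through o, where (1 + g (-p)) / (1 - g p) = e^-2 on the sphere. The
    gauge is handled only as a Lipschitz sublinear function, so spheres have no tangent planes at
    hand; the normal of a ball touching the boundary at the radial projection of p replaces them. A
    short chord from p to q is almost orthogonal to this normal because g q - g p = e^2 (g (-p) - g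
    (-q)) is of order e^2 |p - q|. The two bounds are asymmetric. The upper one covers the whole
    sphere and needs one inner radius for all boundary points. The lower one may discard all but a
    patch, so curvature is exploited near a single boundary point; but the covers there are
    arbitrary countable ones, and compactness of the cube has to reduce them to finite ones. *)

HB.instance Definition _ := Monoid.isComLaw.Build R 0 Rplus
  (fun x y z => esym (Rplus_assoc x y z)) Rplus_comm Rplus_0_l.

Lemma Rabs_le_inv (x a : R) : Rabs x <= a -> - a <= x <= a.
Proof. by rewrite /Rabs; case: Rcase_abs; lra. Qed.

Lemma bigR_scale {I : Type} (s : seq I) (c : R) (f : I -> R) :
  \big[Rplus/0]_(i <- s) (c * f i) = c * \big[Rplus/0]_(i <- s) f i.
Proof.
elim: s => [|i s IH]; first by rewrite !big_nil; ring.
by rewrite !big_cons IH; ring.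
Qed.

Lemma bigR_le {I : Type} (s : seq I) (f g : I -> R) :
  (forall i, f i <= g i) ->
  \big[Rplus/0]_(i <- s) f i <= \big[Rplus/0]_(i <- s) g i.
Proof.
move=> h; elim: s => [|i s IH]; first by rewrite !big_nil; lra.
by rewrite !big_cons; have := h i; lra.
Qed.

Lemma bigR_ge0 {I : Type} (s : seq I) (f : I -> R) :
  (forall i, 0 <= f i) -> 0 <= \big[Rplus/0]_(i <- s) f i.
Proof.
move=> h; elim: s => [|i s IH]; first by rewrite big_nil; lra.
by rewrite big_cons; have := h i; lra.
Qed.

Lemma bigR_Rabs {I : Type} (s : seq I) (f : I -> R) :
  Rabs (\big[Rplus/0]_(i <- s) f i) <= \big[Rplus/0]_(i <- s) Rabs (f i).
Proof.
elim: s => [|i s IH]; first by rewrite !big_nil Rabs_R0; lra.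
by rewrite !big_cons; apply: Rle_trans (Rabs_triang _ _) _; lra.
Qed.

Lemma bigR_const {I : Type} (s : seq I) (c : R) :
  \big[Rplus/0]_(i <- s) c = INR (size s) * c.
Proof.
elim: s => [|i s IH]; first by rewrite big_nil /=; ring.
by rewrite big_cons IH [size (_ :: _)]/= S_INR; ring.
Qed.

Lemma bigR_ord_const (N : nat) (c : R) : \big[Rplus/0]_(i < N) c = INR N * c.
Proof. by rewrite bigR_const /index_enum -enumT size_enum_ord. Qed.

Lemma bigR_ge_term {N : nat} (f : 'I_N -> R) (i : 'I_N) :
  (forall j, 0 <= f j) -> f i <= \big[Rplus/0]_(j < N) f j.
Proof.
move=> h; rewrite (bigD1 i) //=; change (f i <= f i + \big[Rplus/0]_(j < N | j != i) f j).
suff: 0 <= \big[Rplus/0]_(j < N | j != i) f j by lra.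
by apply: (big_ind (fun x => 0 <= x)) => [|x y ? ?|j _]; [lra | lra | exact: h].
Qed.

Definition vzero {N} : pt N := fun _ => 0.
Definition vopp {N} (x : pt N) : pt N := vscale (-1) x.

Ltac vring := apply: functional_extensionality => ?;
  rewrite /vadd /vsub /vopp /vscale /vzero; ring.
Ltac vfield := apply: functional_extensionality => ?;
  rewrite /vadd /vsub /vopp /vscale /vzero; field.

Section Vectors.
Context {N : nat}.
Implicit Types x y z v w : pt N.

Lemma dotC x y : dot x y = dot y x.
Proof. by apply: eq_bigr => i _; ring. Qed.

Lemma dotDl x y z : dot (vadd x y) z = dot x z + dot y z.
Proof. by rewrite /dot -big_split; apply: eq_bigr => i _; rewrite /vadd /=; ring. Qed.

Lemma dotZl c x z : dot (vscale c x) z = c * dot x z.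
Proof. by rewrite /dot -bigR_scale; apply: eq_bigr => i _; rewrite /vscale; ring. Qed.

Lemma dotBl x y z : dot (vsub x y) z = dot x z - dot y z.
Proof.
have -> : vsub x y = vadd x (vscale (-1) y) by vring.
by rewrite dotDl dotZl; ring.
Qed.

Lemma dotDr x y z : dot z (vadd x y) = dot z x + dot z y.
Proof. by rewrite !(dotC z) dotDl. Qed.
Lemma dotZr c x z : dot z (vscale c x) = c * dot z x.
Proof. by rewrite !(dotC z) dotZl. Qed.
Lemma dotBr x y z : dot z (vsub x y) = dot z x - dot z y.
Proof. by rewrite !(dotC z) dotBl. Qed.

Lemma dot_ge0 x : 0 <= dot x x.
Proof. by apply: bigR_ge0 => i; nra. Qed.

Lemma enorm_ge0 x : 0 <= enorm x.
Proof. exact: sqrt_pos. Qed.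

Lemma enorm_sqr x : enorm x * enorm x = dot x x.
Proof. by apply: sqrt_sqrt; apply: dot_ge0. Qed.

Lemma enorm_vzero : enorm (@vzero N) = 0.
Proof.
rewrite /enorm /dot (eq_bigr (fun=> 0)); last by move=> i _; rewrite /vzero; ring.
by rewrite bigR_ord_const Rmult_0_r sqrt_0.
Qed.

Lemma enorm_scale c x : enorm (vscale c x) = Rabs c * enorm x.
Proof.
rewrite /enorm dotZl dotZr -Rmult_assoc sqrt_mult; first by rewrite sqrt_Rsqr_abs.
- by nra.
- exact: dot_ge0.
Qed.

Lemma cauchy_schwarz x y : dot x y * dot x y <= dot x x * dot y y.
Proof.
have h s : 0 <= dot x x - 2 * s * dot x y + s * s * dot y y.
  have := dot_ge0 (vsub x (vscale s y)).
  by rewrite !dotBl !dotBr !dotZl !dotZr (dotC y x); lra.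
have := dot_ge0 y; case=> [py|y0].
  have := h (dot x y / dot y y).
  have -> : dot x x - 2 * (dot x y / dot y y) * dot x y
    + dot x y / dot y y * (dot x y / dot y y) * dot y y
    = (dot x x * dot y y - dot x y * dot x y) / dot y y by field; lra.
  move=> h0; have := Rmult_le_pos _ _ h0 (Rlt_le _ _ py).
  rewrite /Rdiv Rmult_assoc Rinv_l; last by lra.
  by lra.
rewrite -y0.
have e0 : dot x y = 0.
  (* With [dot y y = 0] the nonnegative quadratic in s is affine; a nonzero slope would let this s
     bring it down to -1. *)
  apply: NNPP => ne; have := h ((dot x x + 1) / (2 * dot x y)); rewrite -y0.
  have -> : dot x x - 2 * ((dot x x + 1) / (2 * dot x y)) * dot x y +
    (dot x x + 1) / (2 * dot x y) * ((dot x x + 1) / (2 * dot x y)) * 0 = -1 by field.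
  by lra.
by rewrite e0; lra.
Qed.

Lemma dot_le x y : Rabs (dot x y) <= enorm x * enorm y.
Proof.
apply: Rsqr_incr_0_var; last by apply: Rmult_le_pos; exact: enorm_ge0.
rewrite -Rsqr_abs /Rsqr; have := cauchy_schwarz x y; rewrite -(enorm_sqr x) -(enorm_sqr y); lra.
Qed.

Lemma dot_le_norm x y : dot x y <= enorm x * enorm y.
Proof. by apply: Rle_trans (Rle_abs _) (dot_le x y). Qed.

Lemma enormD x y : enorm (vadd x y) <= enorm x + enorm y.
Proof.
apply: Rsqr_incr_0_var; last by have := enorm_ge0 x; have := enorm_ge0 y; lra.
rewrite /Rsqr enorm_sqr dotDl !dotDr (dotC y x) -!enorm_sqr.
by have := dot_le_norm x y; nra.
Qed.

Lemma enorm_subC x y : enorm (vsub x y) = enorm (vsub y x).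
Proof.
have -> : vsub x y = vscale (-1) (vsub y x) by vring.
by rewrite enorm_scale Rabs_Ropp Rabs_R1; ring.
Qed.

Lemma enormB x y : enorm (vsub x y) <= enorm x + enorm y.
Proof.
have -> : vsub x y = vadd x (vscale (-1) y) by vring.
by apply: Rle_trans (enormD _ _) _; rewrite enorm_scale Rabs_Ropp Rabs_R1; lra.
Qed.

Lemma enorm_triangle y x z : enorm (vsub x z) <= enorm (vsub x y) + enorm (vsub y z).
Proof.
have -> : vsub x z = vadd (vsub x y) (vsub y z) by vring.
exact: enormD.
Qed.

Lemma coord_le x i : Rabs (x i) <= enorm x.
Proof.
apply: Rsqr_incr_0_var; last exact: enorm_ge0.
rewrite -Rsqr_abs /Rsqr enorm_sqr.
by apply: (bigR_ge_term (fun j => x j * x j)) => j; nra.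
Qed.

(** The sharp factor is the square root of N; N itself avoids the root and suffices, by N <= N^2 for
    natural numbers. *)
Lemma enorm_le_coords x b : 0 <= b -> (forall i, Rabs (x i) <= b) -> enorm x <= INR N * b.
Proof.
move=> b0 h; apply: Rsqr_incr_0_var; last first.
  by apply: Rmult_le_pos => //; apply: pos_INR.
rewrite /Rsqr enorm_sqr.
have: dot x x <= INR N * (b * b).
  rewrite -bigR_ord_const; apply: bigR_le => i.
  by have := h i; rewrite /Rabs; case: Rcase_abs => ? ?; nra.
have : INR N <= INR N * INR N.
  rewrite -mult_INR; apply: le_INR; apply/leP.
  by rewrite /muln_rec; case: N => // k; rewrite multE leq_pmulr.
have bb : 0 <= b * b by nra.
by nra.
Qed.

Lemma enorm_eq0 x : enorm x = 0 -> x = vzero.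
Proof.
move=> x0; apply: functional_extensionality => i.
have := coord_le x i; rewrite x0 /vzero.
by have := Rabs_pos (x i); rewrite /Rabs; case: Rcase_abs => *; lra.
Qed.

Lemma enorm_gt0 x : x <> vzero -> 0 < enorm x.
Proof.
by move=> nx; case: (enorm_ge0 x) => // e; case: nx; apply: enorm_eq0.
Qed.

Lemma vsub_eq0 x y : vsub x y = vzero -> x = y.
Proof.
move=> h; apply: functional_extensionality => i.
by move: (f_equal (@^~ i) h); rewrite /vsub /vzero; lra.
Qed.

Lemma enorm_basis i : enorm (@basis N i) = 1.
Proof.
rewrite /enorm /dot (bigD1 i) //= big1 => [|j ji]; rewrite /basis.
  by rewrite eqxx Rmult_1_l Rplus_0_r sqrt_1.
by rewrite (negbTE ji); ring.
Qed.

End Vectors.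

(** * Bolzano-Weierstrass in R and in R^N *)

Lemma bounded_cluster_R (u : nat -> R) (M : R) :
  (forall k, Rabs (u k) <= M) ->
  exists (phi : nat -> nat) (l : R), (forall k, (k <= phi k)%coq_nat) /\ Un_cv (fun k => u (phi k)) l.
Proof.
move=> hb.
have [l hl] : exists l, ValAdh u l.
  apply: (Bolzano_Weierstrass u (fun x => -M <= x <= M)); first exact: compact_P3.
  by move=> k; move: (hb k); rewrite /Rabs; case: Rcase_abs; lra.
have hk (k : nat) : exists p, (k <= p)%coq_nat /\ Rabs (u p - l) < / (INR k + 1).
  have pk : 0 < / (INR k + 1) by apply: Rinv_0_lt_compat; have := pos_INR k; lra.
  have [] := hl (fun x => Rabs (x - l) < / (INR k + 1)) k.
    by exists (mkposreal _ pk) => x.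
  by move=> p hp; exists p.
have [phi hphi] : exists phi : nat -> nat, forall k, (k <= phi k)%coq_nat /\ Rabs (u (phi k) - l) < / (INR k + 1).
  by exists (fun k => proj1_sig (constructive_indefinite_description _ (hk k))) => k;
     case: constructive_indefinite_description.
exists phi, l; split; first by move=> k; case: (hphi k).
move=> eps heps.
have [K [hK hK0]] := archimed_cor1 eps heps.
exists K => k kK; rewrite /R_dist.
apply: Rlt_trans (proj2 (hphi k)) _.
apply: Rlt_trans hK.
apply: Rinv_lt_contravar.
  by apply: Rmult_lt_0_compat; [exact: lt_0_INR | have := pos_INR k; lra].
by have := le_INR _ _ kK; lra.
Qed.

(** Reindexings with [k <= phi k] stand in for subsequences: they are stable under composition and
    preserve limits, and no monotonicity has to be arranged. *)
Lemma Un_cv_sub (u : nat -> R) (l : R) (phi : nat -> nat) :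
  (forall k, (k <= phi k)%coq_nat) -> Un_cv u l -> Un_cv (fun k => u (phi k)) l.
Proof.
move=> hphi hu eps /hu [K hK]; exists K => k kK; apply: hK.
by rewrite /ge; apply: PeanoNat.Nat.le_trans kK _.
Qed.

Lemma bounded_cluster {N : nat} (x : nat -> pt N) (M : R) :
  (forall k, enorm (x k) <= M) ->
  exists l : pt N, forall eps, 0 < eps -> forall K : nat, exists k : nat,
    (K <= k)%coq_nat /\ enorm (vsub (x k) l) < eps.
Proof.
move=> hb.
(* One coordinate at a time: a reindexing making the first d coordinates converge is refined so that
   coordinate d converges too. *)
have main (d : nat) : (d <= N)%nat -> exists (phi : nat -> nat) (l : pt N),
    (forall k, (k <= phi k)%coq_nat) /\
    forall i : 'I_N, (i < d)%nat -> Un_cv (fun k => x (phi k) i) (l i).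
  elim: d => [|d IH] hd; first by exists (fun k : nat => k), vzero.
  have [phi [l [hphi hl]]] := IH (ltnW hd).
  have hbd k : Rabs (x (phi k) (Ordinal hd)) <= M.
    exact: Rle_trans (coord_le _ _) (hb _).
  have [psi [l' [hpsi hl']]] := bounded_cluster_R _ _ hbd.
  exists (fun k => phi (psi k)), (fun i => if i == Ordinal hd then l' else l i).
  split=> [k|i hi].
    exact: PeanoNat.Nat.le_trans (hpsi k) (hphi _).
  case: eqP => [->//|ni].
  apply: (@Un_cv_sub (fun k => x (phi k) i)) => //; apply: hl.
  move: hi; rewrite ltnS leq_eqVlt => /orP [/eqP e|//].
  by case: ni; apply: val_inj.
have [phi [l [hphi hl]]] := main N (leqnn N).
exists l => eps heps K.
set e := eps / (INR N + 1).
have N0 := pos_INR N.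
have he : 0 < e by apply: Rdiv_lt_0_compat; lra.
have [K' hK'] : exists K' : nat, forall i : 'I_N, forall k, (K' <= k)%coq_nat -> Rabs (x (phi k) i - l i) < e.
  have hi (i : 'I_N) := hl i (ltn_ord i) e he.
  pose f i := proj1_sig (constructive_indefinite_description _ (hi i)).
  exists (\max_(i < N) f i)%nat => i k hk.
  move: (proj2_sig (constructive_indefinite_description _ (hi i))); rewrite -/(f i).
  apply; apply/leP; apply: leq_trans (introT leP hk).
  exact: leq_bigmax.
exists (phi (K + K')%coq_nat); split.
  by have := hphi (K + K')%coq_nat; lia.
have : enorm (vsub (x (phi (K + K')%coq_nat)) l) <= INR N * e.
  apply: enorm_le_coords; first by lra.
  by move=> i; apply: Rlt_le; apply: hK'; lia.
have : INR N * e < eps; last by lra.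
rewrite /e; have -> : INR N * (eps / (INR N + 1)) = eps - eps / (INR N + 1) by field; lra.
by rewrite -/e; lra.
Qed.

(** * The gauge of a convex domain *)

Lemma is_inf_exists (S : R -> Prop) (b : R) :
  (exists s, S s) -> (forall s, S s -> b <= s) -> exists m, is_inf S m.
Proof.
move=> [s0 hs0] hb.
have [||m [hub hlub]] := completeness (fun s => S (- s)).
- by exists (- b) => s /hb; lra.
- by exists (- s0); rewrite Ropp_involutive.
exists (- m); split=> [s hs|m' hm'].
  by have := hub (- s); rewrite Ropp_involutive => /(_ hs); lra.
have : m <= - m' by apply: hlub => s /hm'; lra.
by lra.
Qed.

Lemma is_inf_lt (S : R -> Prop) (m c : R) : is_inf S m -> m < c -> exists s, S s /\ s < c.
Proof.
move=> [_ hm] mc; apply: NNPP => h.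
suff : c <= m by lra.
apply: hm => s hs; case: (Rle_lt_dec c s) => // sc.
by case: h; exists s.
Qed.

Lemma le_epsilon_mul (a b c : R) : 0 < c ->
  (forall eps, 0 < eps -> a < b + c * eps) -> a <= b.
Proof.
move=> c0 h; case: (Rle_lt_dec a b) => // ab.
have := h ((a - b) / c) ltac:(apply: Rdiv_lt_0_compat; lra).
have -> : c * ((a - b) / c) = a - b by field; lra.
by lra.
Qed.

(** The properties of the Minkowski functional of U - o that are used. Geometrically, U contains the
    ball of radius 1/L about o and lies in the ball of radius M about o. The gauge is not symmetric:
    g (-x) and g x may differ. *)
Record is_gauge {N} (U : pt N -> Prop) (o : pt N) (g : pt N -> R) (L M : R) : Prop := IsGauge {
  gauge_L : 0 < L;
  gauge_M : 0 < M;
  gauge_scale : forall c x, 0 <= c -> g (vscale c x) = c * g x;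
  gauge_add : forall x y, g (vadd x y) <= g x + g y;
  gauge_le : forall x, g x <= L * enorm x;
  gauge_ge : forall x, enorm x <= M * g x;
  gauge_in : forall x, U (vadd o x) <-> g x < 1;
  gauge_bdry : forall x, bdry U (vadd o x) <-> g x = 1
}.

Lemma gauge_exists {N} (U : pt N -> Prop) (o : pt N) :
  is_open U -> is_bounded U -> is_convex U -> U o ->
  exists g L M, is_gauge U o g L M.
Proof.
move=> Uopen [M0 hM0] Uconv Uo.
have [a [a0 ha]] := Uopen o Uo.
pose A x s := 0 < s /\ U (vadd o (vscale (/ s) x)).
have upA x s s' : A x s -> s <= s' -> A x s'.
  move=> [s0 hs] ss'; split; first by lra.
  (* [A x] is upward closed, since o + x/s' lies on the segment from o to o + x/s. *)
  have -> : vadd o (vscale (/ s') x)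
    = vadd (vscale (1 - s / s') o) (vscale (s / s') (vadd o (vscale (/ s) x))).
    by vfield; split; lra.
  apply: Uconv => //; split; first by apply: Rlt_le; apply: Rdiv_lt_0_compat; lra.
  by apply: (Rmult_le_reg_r s'); first lra; rewrite /Rdiv Rmult_assoc Rinv_l; lra.
have inA x s : enorm x / a < s -> A x s.
  move=> h; have xa : 0 <= enorm x / a.
    by apply: Rmult_le_pos; [exact: enorm_ge0 | apply: Rlt_le; apply: Rinv_0_lt_compat].
  split; first by lra.
  apply: ha; rewrite /eball.
  have -> : vsub (vadd o (vscale (/ s) x)) o = vscale (/ s) x by vring.
  have si : 0 < / s by apply: Rinv_0_lt_compat; lra.
  rewrite enorm_scale Rabs_pos_eq; last by lra.
  apply: (Rmult_lt_reg_l s); first by lra.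
  rewrite -Rmult_assoc Rinv_r; last by lra.
  have : enorm x / a * a < s * a by apply: Rmult_lt_compat_r.
  have -> : enorm x / a * a = enorm x by field; lra.
  by lra.
pose M := Rabs M0 + enorm o + 1.
have M_gt0 : 0 < M by have := Rabs_pos M0; have := enorm_ge0 o; rewrite /M; lra.
have geA x s : A x s -> enorm x / M <= s.
  move=> [s0 /hM0 hs].
  have : enorm (vscale (/ s) x) <= M.
    have -> : vscale (/ s) x = vsub (vadd o (vscale (/ s) x)) o by vring.
    apply: Rle_trans (enormB _ _) _.
    by have := Rle_abs M0; rewrite /M; lra.
  rewrite enorm_scale Rabs_pos_eq; last by apply: Rlt_le; apply: Rinv_0_lt_compat.
  move=> h; apply: (Rmult_le_reg_r M) => //.
  rewrite /Rdiv Rmult_assoc Rinv_l; last by lra.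
  have := Rmult_le_compat_l s _ _ (Rlt_le _ _ s0) h.
  by rewrite -Rmult_assoc Rinv_r; lra.
have infA x : exists m, is_inf (A x) m.
  apply: (is_inf_exists _ (enorm x / M)); last exact: geA.
  by exists (enorm x / a + 1); apply: inA; lra.
pose g x := proj1_sig (constructive_indefinite_description _ (infA x)).
have gP x : is_inf (A x) (g x) by rewrite /g; case: constructive_indefinite_description.
have ltA x s : g x < s -> A x s.
  by move=> /(is_inf_lt _ _ _ (gP x)) [s' [hs' ss']]; apply: upA hs' _; lra.
have leA x s : A x s -> g x <= s by move=> h; apply: (proj1 (gP x)).
have ge x : enorm x <= M * g x.
  have := proj2 (gP x) _ (geA x) => h.
  have := Rmult_le_compat_l M _ _ (Rlt_le _ _ M_gt0) h.
  have -> : M * (enorm x / M) = enorm x by field; lra.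
  by [].
have g0 x : 0 <= g x by have := ge x; have := enorm_ge0 x; nra.
have le x : g x <= / a * enorm x.
  case: (Rle_lt_dec (g x) (/ a * enorm x)) => // h.
  have := leA x _ (inA x ((enorm x / a + g x) / 2) ltac:(rewrite /Rdiv in h *; lra)).
  by rewrite /Rdiv in h *; lra.
have ai : 0 < / a by apply: Rinv_0_lt_compat.
have scale_le c x : 0 < c -> g (vscale c x) <= c * g x.
  move=> c0; apply: (le_epsilon_mul _ _ c) => // eps heps.
  have [s0 hs] := ltA x (g x + eps / 2) ltac:(lra).
  have : g (vscale c x) <= c * (g x + eps / 2).
    apply: leA; split; first by apply: Rmult_lt_0_compat.
    suff -> : vscale (/ (c * (g x + eps / 2))) (vscale c x) = vscale (/ (g x + eps / 2)) x by [].
    by vfield; split; lra.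
  by nra.
have scale c x : 0 <= c -> g (vscale c x) = c * g x.
  case=> [c0|<-]; last first.
    have -> : vscale 0 x = vzero by vring.
    by have := g0 vzero; have := le vzero; rewrite enorm_vzero; lra.
  apply: Rle_antisym; first exact: scale_le.
  have ci : 0 < / c by apply: Rinv_0_lt_compat.
  have := scale_le (/ c) (vscale c x) ci.
  have -> : vscale (/ c) (vscale c x) = x by vfield; lra.
  move=> h; have := Rmult_le_compat_l c _ _ (Rlt_le _ _ c0) h.
  by rewrite -Rmult_assoc Rinv_r; lra.
have add x y : g (vadd x y) <= g x + g y.
  apply: (le_epsilon_mul _ _ 2); first by lra.
  move=> eps heps.
  set s := g x + eps / 2; set t := g y + eps / 2.
  have [s0 hs] : A x s by apply: ltA; rewrite /s; lra.
  have [t0 ht] : A y t by apply: ltA; rewrite /t; lra.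
  have : g (vadd x y) <= s + t; last by rewrite /s /t; lra.
  apply: leA; split; first by lra.
  have -> : vadd o (vscale (/ (s + t)) (vadd x y)) =
    vadd (vscale (1 - t / (s + t)) (vadd o (vscale (/ s) x)))
         (vscale (t / (s + t)) (vadd o (vscale (/ t) y))).
    by vfield; lra.
  apply: Uconv => //; split; first by apply: Rlt_le; apply: Rdiv_lt_0_compat; lra.
  by apply: (Rmult_le_reg_r (s + t)); first lra; rewrite /Rdiv Rmult_assoc Rinv_l; lra.
have inU x : U (vadd o x) <-> g x < 1.
  split=> [Ux|]; last first.
    move=> /ltA [_]; have -> // : vscale (/ 1) x = x by vfield.
  (* Openness makes the inequality strict: (1 + eps) x still lies in the domain, whence g x <= 1 /
     (1 + eps). *)
  have [r [r0 hr]] := Uopen _ Ux.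
  set eps := r / (enorm x + 1).
  have x0 := enorm_ge0 x.
  have heps : 0 < eps by apply: Rdiv_lt_0_compat; lra.
  have : g x <= / (1 + eps).
    apply: leA; split; first by apply: Rinv_0_lt_compat; lra.
    apply: hr; rewrite /eball.
    have -> : vsub (vadd o (vscale (/ / (1 + eps)) x)) (vadd o x) = vscale eps x.
      by vfield; lra.
    rewrite enorm_scale Rabs_pos_eq; last by lra.
    have -> : r = eps * (enorm x + 1) by rewrite /eps; field; lra.
    by nra.
  have : / (1 + eps) < 1 by rewrite -[X in _ < X]Rinv_1; apply: Rinv_lt_contravar; lra.
  by lra.
exists g, (/ a), M; split=> // x; split=> [[hcl nU]|gx].
  have g1 : 1 <= g x by case: (Rle_lt_dec 1 (g x)) => // /inU.
  apply: Rle_antisym => //.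
  apply: (le_epsilon_mul _ _ (/ a)) => // eps heps.
  have [y [Uy hy]] := hcl eps heps.
  have yE : y = vadd o (vsub y o) by vring.
  have : g (vsub y o) < 1 by apply/inU; rewrite -yE.
  have := add (vsub y o) (vsub (vadd o x) y).
  have -> : vadd (vsub y o) (vsub (vadd o x) y) = x by vring.
  have := le (vsub (vadd o x) y); rewrite enorm_subC.
  by have := Rmult_lt_compat_l _ _ _ ai hy; lra.
split; last by move/inU; lra.
move=> eps heps; have x0 := enorm_ge0 x.
(* The approximating point of U is (1 - eta) x, at distance eta |x| < eps; the cap 1/2 keeps 1 - eta
   nonnegative, as homogeneity of the gauge requires. *)
set eta := Rmin (1 / 2) (eps / 2 / (enorm x + 1)).
have eta0 : 0 < eta.
  by apply: Rmin_pos; first lra; apply: Rdiv_lt_0_compat; lra.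
have eta1 : eta <= 1 / 2 by apply: Rmin_l.
have eta2 : eta * (enorm x + 1) <= eps / 2.
  apply: (Rle_trans _ (eps / 2 / (enorm x + 1) * (enorm x + 1))).
    by apply: Rmult_le_compat_r; [lra | apply: Rmin_r].
  by right; field; lra.
exists (vadd o (vscale (1 - eta) x)); split.
  by apply/inU; rewrite scale ?gx; lra.
have -> : vsub (vadd o (vscale (1 - eta) x)) (vadd o x) = vscale (- eta) x by vring.
by rewrite enorm_scale Rabs_Ropp Rabs_pos_eq; nra.
Qed.

(** * Chords and the Hilbert distance in terms of the gauge *)

Section GaugeTheory.
Context {N : nat} {U : pt N -> Prop} {o : pt N} {g : pt N -> R} {L M : R}.
Hypothesis hg : is_gauge U o g L M.

Lemma gauge_ge0 x : 0 <= g x.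
Proof. by have := gauge_ge _ _ _ _ _ hg x; have := enorm_ge0 x; have := gauge_M _ _ _ _ _ hg; nra. Qed.

Lemma gauge_gt0 x : x <> vzero -> 0 < g x.
Proof.
move=> /enorm_gt0 x0; have := gauge_ge _ _ _ _ _ hg x; have := gauge_M _ _ _ _ _ hg.
by have := gauge_ge0 x; nra.
Qed.

Lemma gauge_vzero : g vzero = 0.
Proof.
have := gauge_ge0 vzero; have := gauge_le _ _ _ _ _ hg vzero.
by rewrite enorm_vzero; lra.
Qed.

Lemma gauge_sub x y : g x - g y <= L * enorm (vsub x y).
Proof.
have := gauge_add _ _ _ _ _ hg y (vsub x y).
have -> : vadd y (vsub x y) = x by vring.
by have := gauge_le _ _ _ _ _ hg (vsub x y); lra.
Qed.

Lemma gauge_lip x y : Rabs (g x - g y) <= L * enorm (vsub x y).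
Proof.
by apply: Rabs_le; have := gauge_sub x y; have := gauge_sub y x; rewrite enorm_subC; lra.
Qed.

Lemma gauge_convex p q s : 0 <= s <= 1 ->
  g (vadd p (vscale s (vsub q p))) <= (1 - s) * g p + s * g q.
Proof.
move=> hs; have -> : vadd p (vscale s (vsub q p)) = vadd (vscale (1 - s) p) (vscale s q) by vring.
apply: Rle_trans (gauge_add _ _ _ _ _ hg _ _) _.
by rewrite !(gauge_scale _ _ _ _ _ hg); lra.
Qed.

Lemma chord_end (p w : pt N) : g p < 1 -> w <> vzero ->
  exists s, 0 < s /\ g (vadd p (vscale s w)) = 1.
Proof.
move=> gp /enorm_gt0 w0.
pose f s := g (vadd p (vscale s w)) - 1.
have L0 := gauge_L _ _ _ _ _ hg; have M0 := gauge_M _ _ _ _ _ hg.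
have fcont : continuity f.
  move=> s eps heps; exists (eps / (L * enorm w + 1)).
  have Lw : 0 < L * enorm w by apply: Rmult_lt_0_compat.
  split; first by apply: Rdiv_lt_0_compat; lra.
  move=> s' [_]; rewrite /= /R_dist /f => hs.
  have -> : g (vadd p (vscale s' w)) - 1 - (g (vadd p (vscale s w)) - 1) =
    g (vadd p (vscale s' w)) - g (vadd p (vscale s w)) by ring.
  apply: Rle_lt_trans (gauge_lip _ _) _.
  have -> : vsub (vadd p (vscale s' w)) (vadd p (vscale s w)) = vscale (s' - s) w by vring.
  rewrite enorm_scale.
  have : Rabs (s' - s) * (L * enorm w + 1) < eps.
    have := Rmult_lt_compat_r (L * enorm w + 1) _ _ ltac:(lra) hs.
    have -> : eps / (L * enorm w + 1) * (L * enorm w + 1) = eps by field; lra.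
    by [].
  have := Rabs_pos (s' - s); nra.
have f0 : f 0 < 0.
  rewrite /f; have -> : vadd p (vscale 0 w) = p by vring.
  by lra.
(* At this parameter the point of the ray has norm at least M + 1, so its gauge exceeds 1 and the
   intermediate value theorem applies. *)
set b := (M + enorm p + 1) / enorm w.
have b0 : 0 < b by apply: Rdiv_lt_0_compat => //; have := enorm_ge0 p; lra.
have fb : 0 < f b.
  rewrite /f; have := gauge_ge _ _ _ _ _ hg (vadd p (vscale b w)).
  have := enormB (vadd p (vscale b w)) p.
  have -> : vsub (vadd p (vscale b w)) p = vscale b w by vring.
  rewrite enorm_scale Rabs_pos_eq; last by lra.
  have -> : b * enorm w = M + enorm p + 1 by rewrite /b; field; lra.
  by nra.
have [s [hs fs]] := IVT f 0 b fcont b0 f0 fb.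
exists s; split; last by rewrite /f in fs; lra.
case: (Req_dec s 0) => [s0|]; last by lra.
by move: fs; rewrite s0; lra.
Qed.

Lemma bdry_vadd p w s : bdry U (vadd (vadd o p) (vscale s w)) <-> g (vadd p (vscale s w)) = 1.
Proof.
have -> : vadd (vadd o p) (vscale s w) = vadd o (vadd p (vscale s w)) by vring.
exact: gauge_bdry hg _.
Qed.

(** Half the logarithm of the cross-ratio in the affine parameter of the line p + s (q - p): p sits
    at 0, q at 1, the ends of the chord at s1 < 0 and s2 > 1. *)
Definition cross_log (s1 s2 : R) : R := / 2 * ln ((1 - s1) * s2 / ((s2 - 1) * - s1)).

(** All four Euclidean lengths are multiples of |q - p|, which cancels. [hdist] only asks s1 <= 0 <=
    s2; convexity keeps boundary points off the parameters in [0, 1], hence the strict bounds. *)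
Lemma hdist_gauge p q d : p <> q -> g p < 1 -> g q < 1 ->
  hdist U (vadd o p) (vadd o q) d <->
  exists s1 s2, s1 < 0 /\ 1 < s2 /\ g (vadd p (vscale s1 (vsub q p))) = 1 /\
    g (vadd p (vscale s2 (vsub q p))) = 1 /\ d = cross_log s1 s2.
Proof.
move=> npq gp gq.
have nopq : vadd o p <> vadd o q.
  move=> h; apply: npq; apply: functional_extensionality => i.
  by move: (f_equal (@^~ i) h); rewrite /vadd; lra.
have wE : vsub (vadd o q) (vadd o p) = vsub q p by vring.
have wpos : 0 < enorm (vsub q p).
  by apply: enorm_gt0 => /vsub_eq0 e; apply: npq.
have outside s : g (vadd p (vscale s (vsub q p))) = 1 -> ~ (0 <= s <= 1).
  by move=> gs hs; have := gauge_convex p q s hs; rewrite gs; case: (Rle_lt_dec s (1 / 2)) => ?; nra.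
have ratio s1 s2 : s1 < 0 -> 1 < s2 ->
  / 2 * ln (enorm (vsub (vadd o q) (vadd (vadd o p) (vscale s1 (vsub q p)))) *
     enorm (vsub (vadd o p) (vadd (vadd o p) (vscale s2 (vsub q p)))) /
    (enorm (vsub (vadd o q) (vadd (vadd o p) (vscale s2 (vsub q p)))) *
     enorm (vsub (vadd o p) (vadd (vadd o p) (vscale s1 (vsub q p)))))) = cross_log s1 s2.
  move=> h1 h2.
  have e1 s : vsub (vadd o q) (vadd (vadd o p) (vscale s (vsub q p))) = vscale (1 - s) (vsub q p) by vring.
  have e2 s : vsub (vadd o p) (vadd (vadd o p) (vscale s (vsub q p))) = vscale (- s) (vsub q p) by vring.
  rewrite !e1 !e2 !enorm_scale Rabs_Ropp (Rabs_pos_eq s2); last by lra.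
  rewrite (Rabs_pos_eq (1 - s1)); last by lra.
  rewrite (Rabs_pos_eq (- s1)); last by lra.
  rewrite (Rabs_left (1 - s2)); last by lra.
  rewrite /cross_log; congr (_ * ln _); field; lra.
split.
  case=> [[e _]|[_ [s1 [s2 [h1 [h2 /=]]]]]]; first by case: nopq.
  rewrite wE => -[/bdry_vadd b1 [/bdry_vadd b2 ->]].
  have := outside _ b1; have := outside _ b2 => o1 o2.
  have hs1 : s1 < 0 by case: (Rlt_le_dec s1 0) => // ?; case: o1; lra.
  have hs2 : 1 < s2 by case: (Rlt_le_dec 1 s2) => // ?; case: o2; lra.
  by exists s1, s2; rewrite ratio.
move=> [s1 [s2 [h1 [h2 [b1 [b2 ->]]]]]].
right; split=> //; exists s1, s2; rewrite wE /=.
split; first by lra.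
split; first by lra.
by rewrite !bdry_vadd ratio.
Qed.

End GaugeTheory.

(** * Second order Taylor expansion *)

Lemma derivable_pt_lim_eq (f : R -> R) (x l l' : R) :
  derivable_pt_lim f x l -> l = l' -> derivable_pt_lim f x l'.
Proof. by move=> h <-. Qed.

Lemma derivable_pt_lim_sum {I : Type} (s : seq I) (F : I -> R -> R) (F' : I -> R) (x : R) :
  (forall i, derivable_pt_lim (F i) x (F' i)) ->
  derivable_pt_lim (fun t => \big[Rplus/0]_(i <- s) F i t) x (\big[Rplus/0]_(i <- s) F' i).
Proof.
move=> h; elim: s => [|i s IH].
  rewrite big_nil.
  have -> : (fun t => \big[Rplus/0]_(i <- [::]) F i t) = fct_cte 0.
    by apply: functional_extensionality => t; rewrite big_nil.
  exact: derivable_pt_lim_const.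
rewrite big_cons.
have -> : (fun t => \big[Rplus/0]_(i <- i :: s) F i t) =
    (F i + (fun t => \big[Rplus/0]_(i <- s) F i t))%F.
  by apply: functional_extensionality => t; rewrite big_cons.
exact: derivable_pt_lim_plus.
Qed.

(** Two mean value arguments for f minus its linear part minus A s^2, where A is chosen so that this
    difference has equal values at 0 and 1. *)
Lemma taylor_lagrange2 (f f1 f2 : R -> R) :
  (forall s, 0 <= s <= 1 -> derivable_pt_lim f s (f1 s)) ->
  (forall s, 0 <= s <= 1 -> derivable_pt_lim f1 s (f2 s)) ->
  exists xi, 0 < xi < 1 /\ f 1 = f 0 + f1 0 + / 2 * f2 xi.
Proof.
move=> h1 h2; set A := f 1 - f 0 - f1 0.
pose F s := f s - (f1 0 * s + A * (s * s)).
pose F1 s := f1 s - (f1 0 + 2 * A * s).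
have dF s : 0 <= s <= 1 -> derivable_pt_lim F s (F1 s).
  move=> hs; apply: derivable_pt_lim_minus; first exact: h1.
  apply: (derivable_pt_lim_eq _ _ (f1 0 * 1 + A * (1 * s + s * 1))); last by ring.
  apply: (derivable_pt_lim_plus (fun s => f1 0 * s) (fun s => A * (s * s))).
    exact/derivable_pt_lim_scal/derivable_pt_lim_id.
  apply: derivable_pt_lim_scal.
  by apply: derivable_pt_lim_mult; apply: derivable_pt_lim_id.
have dF1 s : 0 <= s <= 1 -> derivable_pt_lim F1 s (f2 s - 2 * A).
  move=> hs; apply: derivable_pt_lim_minus; first exact: h2.
  apply: (derivable_pt_lim_eq _ _ (0 + 2 * A * 1)); last by ring.
  apply: derivable_pt_lim_plus; first exact: derivable_pt_lim_const.
  exact/derivable_pt_lim_scal/derivable_pt_lim_id.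
have [c [hc c01]] := MVT_cor2 F F1 0 1 ltac:(lra) dF.
have F1c : F1 c = 0 by move: hc; rewrite /F /A; lra.
have [xi [hxi xi0]] := MVT_cor2 F1 (fun s => f2 s - 2 * A) 0 c ltac:(lra)
  (fun s hs => dF1 s ltac:(lra)).
exists xi; split; first by lra.
have F10 : F1 0 = 0 by rewrite /F1; ring.
rewrite F1c F10 in hxi.
have : f2 xi = 2 * A by nra.
by rewrite /A; lra.
Qed.

Section Calculus.
Context {N : nat}.
Implicit Types (x y v : pt N) (f : pt N -> R).

(** [has_partial] is a derivative at parameter 0 of a line based at the point itself; the chain rule
    transports it to parameter t of a line with a fixed base point, as the mean value theorem
    needs. *)
Lemma derive_line f y v c t l :
  derivable_pt_lim (fun h => f (vadd (vadd y (vscale (t * c) v)) (vscale h v))) 0 l ->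
  derivable_pt_lim (fun s => f (vadd y (vscale (s * c) v))) t (l * c).
Proof.
move=> h.
have -> : (fun s => f (vadd y (vscale (s * c) v))) =
  comp (fun h => f (vadd (vadd y (vscale (t * c) v)) (vscale h v))) (fun s => c * (s - t)).
  by apply: functional_extensionality => s; rewrite /comp; congr f; vring.
apply: derivable_pt_lim_comp; last by rewrite Rminus_diag Rmult_0_r.
apply: (derivable_pt_lim_eq _ _ (c * (1 - 0))); last by ring.
apply: derivable_pt_lim_scal; apply: derivable_pt_lim_minus; first exact: derivable_pt_lim_id.
exact: derivable_pt_lim_const.
Qed.

Lemma dot_basis x i : dot x (basis i) = x i.
Proof.
rewrite /dot (bigD1 i) //= big1 => [|j ji]; rewrite /basis.
  by rewrite eqxx; ring.
by rewrite (negbTE ji); ring.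
Qed.

Lemma eball_center x r : 0 < r -> eball x r x.
Proof.
move=> r0; rewrite /eball; have -> : vsub x x = vzero by vring.
by rewrite enorm_vzero.
Qed.

Lemma eball_segment x0 r x v s : eball x0 r x -> eball x0 r (vadd x v) -> 0 <= s <= 1 ->
  eball x0 r (vadd x (vscale s v)).
Proof.
rewrite /eball => hx hv hs.
have -> : vsub (vadd x (vscale s v)) x0 =
  vadd (vscale (1 - s) (vsub x x0)) (vscale s (vsub (vadd x v) x0)) by vring.
apply: Rle_lt_trans (enormD _ _) _; rewrite !enorm_scale !Rabs_pos_eq; try lra.
by case: (Rle_lt_dec s (1 / 2)) => ?; nra.
Qed.

Definition vtrunc v (k : nat) : pt N := fun i => if (i < k)%nat then v i else 0.

Lemma vtruncS v k (hk : (k < N)%nat) :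
  vtrunc v k.+1 = vadd (vtrunc v k) (vscale (v (Ordinal hk)) (basis (Ordinal hk))).
Proof.
apply: functional_extensionality => i; rewrite /vtrunc /vadd /vscale /basis ltnS leq_eqVlt.
case: (eqVneq i (Ordinal hk)) => [-> /=|ni]; first by rewrite eqxx ltnn /=; ring.
have -> : (i == k :> nat) = false by apply/negP => /eqP e; case/eqP: ni; apply: val_inj.
by case: ifP => _ /=; ring.
Qed.

Lemma partial_increment f gk (i : 'I_N) y c :
  (forall s, 0 <= s <= 1 -> has_partial f i (vadd y (vscale (s * c) (basis i)))
     (gk (vadd y (vscale (s * c) (basis i))))) ->
  exists s, 0 < s < 1 /\
    f (vadd y (vscale c (basis i))) - f y = gk (vadd y (vscale (s * c) (basis i))) * c.
Proof.
move=> h.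
have [s [hs s01]] := MVT_cor2 (fun s => f (vadd y (vscale (s * c) (basis i))))
  (fun s => gk (vadd y (vscale (s * c) (basis i))) * c) 0 1 ltac:(lra)
  (fun s hs => derive_line _ _ _ _ _ _ (h s hs)).
exists s; split=> //; move: hs.
have -> : vadd y (vscale (1 * c) (basis i)) = vadd y (vscale c (basis i)) by vring.
have -> : vadd y (vscale (0 * c) (basis i)) = y by vring.
by move=> ->; ring.
Qed.

(* Telescoping over the coordinates: each truncation [vtrunc v k] adds one
   coordinate step, evaluated by the mean value theorem. *)
Lemma directional_derivative f (g : 'I_N -> pt N -> R) x0 r x v :
  (forall i y, eball x0 r y -> has_partial f i y (g i y)) ->
  (forall i, cont_on (g i) (eball x0 r)) -> eball x0 r x ->
  derivable_pt_lim (fun h => f (vadd x (vscale h v))) 0 (dot (fun i => g i x) v).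
Proof.
move=> hp hc hx.
have vN : vtrunc v N = v.
  by apply: functional_extensionality => i; rewrite /vtrunc ltn_ord.
suff main k : (k <= N)%nat -> derivable_pt_lim (fun h => f (vadd x (vscale h (vtrunc v k)))) 0
    (dot (fun i => g i x) (vtrunc v k)).
  by have := main N (leqnn N); rewrite vN.
elim: k => [_|k IH hk].
  have t0 : vtrunc v 0 = vzero by [].
  have -> : (fun h => f (vadd x (vscale h (vtrunc v 0)))) = fct_cte (f x).
    by apply: functional_extensionality => h; rewrite /fct_cte; congr f; rewrite t0; vring.
  have -> : dot (g^~ x) (vtrunc v 0) = 0.
    by rewrite /dot big1 // => i _; rewrite t0 /vzero; ring.
  exact: derivable_pt_lim_const.
set i := Ordinal hk.
pose D h := f (vadd x (vscale h (vtrunc v k.+1))) - f (vadd x (vscale h (vtrunc v k))).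
have -> : (fun h => f (vadd x (vscale h (vtrunc v k.+1)))) =
    ((fun h => f (vadd x (vscale h (vtrunc v k)))) + D)%F.
  by apply: functional_extensionality => h; rewrite /plus_fct /D; ring.
have -> : dot (g^~ x) (vtrunc v k.+1) = dot (g^~ x) (vtrunc v k) + v i * g i x.
  by rewrite vtruncS dotDr dotZr dot_basis.
apply: derivable_pt_lim_plus; first by apply: IH; apply: ltnW.
move=> eps heps.
set e := eps / (Rabs (v i) + 1).
have vi := Rabs_pos (v i).
have e0 : 0 < e by apply: Rdiv_lt_0_compat; lra.
have [d [d0 hd]] := hc i x hx e e0.
set B := enorm (vtrunc v k) + Rabs (v i) + 1.
have B0 : 0 < B by have := enorm_ge0 (vtrunc v k); rewrite /B; lra.
(* Within rho of x, [g i] varies by less than e and the domain ball is not left; B bounds the norm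
   of the truncated direction, so |h| < rho / B keeps the whole coordinate step there. *)
set rho := Rmin d (r - enorm (vsub x x0)).
have rho0 : 0 < rho by apply: Rmin_pos => //; move: hx; rewrite /eball; lra.
have dpos : 0 < rho / B by apply: Rdiv_lt_0_compat.
exists (mkposreal _ dpos) => h h0 /= hh.
rewrite Rplus_0_l.
have D0 : D 0 = 0.
  rewrite /D; have e2 (u : pt N) : vadd x (vscale 0 u) = x by vring.
  by rewrite !e2; ring.
rewrite D0 Rminus_0_r.
have near s : 0 <= s <= 1 ->
  enorm (vsub (vadd (vadd x (vscale h (vtrunc v k))) (vscale (s * (h * v i)) (basis i))) x) < rho.
  move=> hs.
  have -> : vsub (vadd (vadd x (vscale h (vtrunc v k))) (vscale (s * (h * v i)) (basis i))) x =
    vscale h (vadd (vtrunc v k) (vscale (s * v i) (basis i))) by vring.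
  rewrite enorm_scale.
  have : enorm (vadd (vtrunc v k) (vscale (s * v i) (basis i))) <= B.
    apply: Rle_trans (enormD _ _) _.
    rewrite enorm_scale enorm_basis Rabs_mult (Rabs_pos_eq s); last by lra.
    by rewrite /B; nra.
  have := Rmult_lt_compat_r B _ _ B0 hh.
  have -> : rho / B * B = rho by field; lra.
  have := Rabs_pos h; have := enorm_ge0 (vadd (vtrunc v k) (vscale (s * v i) (basis i))).
  by nra.
have inside s : 0 <= s <= 1 ->
  eball x0 r (vadd (vadd x (vscale h (vtrunc v k))) (vscale (s * (h * v i)) (basis i))).
  move=> hs; rewrite /eball; have := near s hs; have := Rmin_r d (r - enorm (vsub x x0)).
  rewrite -/rho => ? ?; apply: Rle_lt_trans (enorm_triangle x _ _) _; lra.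
have [s [hs Ds]] := partial_increment f (g i) i (vadd x (vscale h (vtrunc v k))) (h * v i)
  (fun s hs => hp i _ (inside s hs)).
have -> : D h = g i (vadd (vadd x (vscale h (vtrunc v k))) (vscale (s * (h * v i)) (basis i))) * (h * v i).
  rewrite -Ds /D vtruncS -/i; congr (f _ - _); vring.
have := hd _ (Rlt_le_trans _ _ _ (near s ltac:(lra)) (Rmin_l _ _)).
set a := g i _ => ha.
have -> : a * (h * v i) / h - v i * g i x = (a - g i x) * v i by field.
rewrite Rabs_mult.
have -> : eps = e * (Rabs (v i) + 1) by rewrite /e; field; lra.
by have := Rabs_pos (a - g i x); nra.
Qed.

(** Reduction to one variable on the segment from x to x + v. The directional derivative is applied
    twice: to f, and then to each [g i]. *)
Lemma taylor2 f (g : 'I_N -> pt N -> R) (H : 'I_N -> 'I_N -> pt N -> R) x0 r x v :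
  (forall i y, eball x0 r y -> has_partial f i y (g i y)) ->
  (forall i, cont_on (g i) (eball x0 r)) ->
  (forall i j y, eball x0 r y -> has_partial (g i) j y (H i j y)) ->
  (forall i j, cont_on (H i j) (eball x0 r)) ->
  eball x0 r x -> eball x0 r (vadd x v) ->
  exists xi, 0 < xi < 1 /\
    f (vadd x v) = f x + dot (fun i => g i x) v + / 2 *
      \big[Rplus/0]_(i < N) \big[Rplus/0]_(j < N) (H i j (vadd x (vscale xi v)) * v i * v j).
Proof.
move=> hf hg hgH hH hx hxv.
have line (F : pt N -> R) (G : 'I_N -> pt N -> R) :
    (forall i y, eball x0 r y -> has_partial F i y (G i y)) ->
    (forall i, cont_on (G i) (eball x0 r)) -> forall s, 0 <= s <= 1 ->
    derivable_pt_lim (fun s => F (vadd x (vscale s v))) s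
      (dot (fun i => G i (vadd x (vscale s v))) v).
  move=> hF hG s hs.
  have := derive_line F x v 1 s (dot (fun i => G i (vadd x (vscale s v))) v).
  have -> : (fun s => F (vadd x (vscale (s * 1) v))) = (fun s => F (vadd x (vscale s v))).
    by apply: functional_extensionality => t; rewrite Rmult_1_r.
  rewrite !Rmult_1_r; apply.
  apply: (directional_derivative _ _ x0 r _ _ hF hG).
  exact: eball_segment.
have line2 s : 0 <= s <= 1 ->
    derivable_pt_lim (fun s => dot (fun i => g i (vadd x (vscale s v))) v) s
      (\big[Rplus/0]_(i < N) (v i * dot (fun j => H i j (vadd x (vscale s v))) v)).
  move=> hs.
  have -> : (fun s => dot (fun i => g i (vadd x (vscale s v))) v) =
      (fun s => \big[Rplus/0]_(i < N) (v i * g i (vadd x (vscale s v)))).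
    by apply: functional_extensionality => t; apply: eq_bigr => i _; ring.
  apply: derivable_pt_lim_sum => i; apply: derivable_pt_lim_scal.
  exact: line (hgH i) (hH i) s hs.
have [xi [hxi e]] := taylor_lagrange2 _ _ _ (line f g hf hg) line2.
exists xi; split=> //; move: e.
have -> : vadd x (vscale 1 v) = vadd x v by vring.
have -> : vadd x (vscale 0 v) = x by vring.
move=> ->; congr (_ + _ * _); apply: eq_bigr => i _.
by rewrite /dot -bigR_scale; apply: eq_bigr => j _; ring.
Qed.

End Calculus.

(** * Quadratic forms and local defining functions *)

Section QuadraticForms.
Context {N : nat}.
Implicit Types (A B : 'I_N -> 'I_N -> R) (u v b : pt N).

Definition quad A v : R := \big[Rplus/0]_(i < N) \big[Rplus/0]_(j < N) (A i j * v i * v j).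

Lemma double_sum_le (f : 'I_N -> 'I_N -> R) c : (forall i j, Rabs (f i j) <= c) ->
  Rabs (\big[Rplus/0]_(i < N) \big[Rplus/0]_(j < N) f i j) <= INR N * INR N * c.
Proof.
move=> h; rewrite Rmult_assoc -!bigR_ord_const.
apply: Rle_trans (bigR_Rabs _ _) _; apply: bigR_le => i.
apply: Rle_trans (bigR_Rabs _ _) _; apply: bigR_le => j; exact: h.
Qed.

Lemma coord_mul_le v i j : Rabs (v i * v j) <= enorm v * enorm v.
Proof.
by rewrite Rabs_mult; apply: Rmult_le_compat; [exact: Rabs_pos | exact: Rabs_pos |
  exact: coord_le | exact: coord_le].
Qed.

Lemma quad_sub_le A B v c : 0 <= c -> (forall i j, Rabs (A i j - B i j) <= c) ->
  Rabs (quad A v - quad B v) <= INR N * INR N * c * (enorm v * enorm v).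
Proof.
move=> c0 h.
have -> : quad A v - quad B v =
    \big[Rplus/0]_(i < N) \big[Rplus/0]_(j < N) ((A i j - B i j) * (v i * v j)).
  have -> : quad A v - quad B v = quad A v + -1 * quad B v by ring.
  rewrite /quad -bigR_scale -big_split; apply: eq_bigr => i _.
  by rewrite -bigR_scale -big_split; apply: eq_bigr => j _ /=; ring.
rewrite [X in _ <= X]Rmult_assoc; apply: double_sum_le => i j; rewrite Rabs_mult.
by apply: Rmult_le_compat => //; [exact: Rabs_pos | exact: Rabs_pos | exact: coord_mul_le].
Qed.

Lemma quad_le A v c : 0 <= c -> (forall i j, Rabs (A i j) <= c) ->
  Rabs (quad A v) <= INR N * INR N * c * (enorm v * enorm v).
Proof.
move=> c0 h; rewrite /quad [X in _ <= X]Rmult_assoc; apply: double_sum_le => i j.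
rewrite Rmult_assoc Rabs_mult.
by apply: Rmult_le_compat => //; [exact: Rabs_pos | exact: Rabs_pos | exact: coord_mul_le].
Qed.

Lemma quad_lip A u v c : 0 <= c -> (forall i j, Rabs (A i j) <= c) ->
  Rabs (quad A u - quad A v) <= INR N * INR N * (c * (enorm (vsub u v) * (enorm u + enorm v))).
Proof.
move=> c0 h.
have -> : quad A u - quad A v =
    \big[Rplus/0]_(i < N) \big[Rplus/0]_(j < N) (A i j * (u i * u j - v i * v j)).
  have -> : quad A u - quad A v = quad A u + -1 * quad A v by ring.
  rewrite /quad -bigR_scale -big_split; apply: eq_bigr => i _.
  by rewrite -bigR_scale -big_split; apply: eq_bigr => j _ /=; ring.
apply: double_sum_le => i j; rewrite Rabs_mult.
apply: Rmult_le_compat => //; try exact: Rabs_pos.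
have -> : u i * u j - v i * v j = vsub u v i * u j + vsub u v j * v i.
  by rewrite /vsub; ring.
apply: Rle_trans (Rabs_triang _ _) _; rewrite !Rabs_mult.
have := coord_le (vsub u v) i; have := coord_le (vsub u v) j.
have := coord_le u j; have := coord_le v i.
have := Rabs_pos (vsub u v i); have := Rabs_pos (vsub u v j).
have := Rabs_pos (u j); have := Rabs_pos (v i).
by move=> *; nra.
Qed.

Lemma entries_bounded A : exists c, 0 < c /\ forall i j, Rabs (A i j) <= c.
Proof.
exists (1 + \big[Rplus/0]_(i < N) \big[Rplus/0]_(j < N) Rabs (A i j)); split.
  have : 0 <= \big[Rplus/0]_(i < N) \big[Rplus/0]_(j < N) Rabs (A i j).
    by apply: bigR_ge0 => i; apply: bigR_ge0 => j; apply: Rabs_pos.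
  by lra.
move=> i j.
have := bigR_ge_term (fun j => Rabs (A i j)) j (fun j => Rabs_pos _).
have := bigR_ge_term (fun i => \big[Rplus/0]_(j < N) Rabs (A i j)) i
  (fun i => bigR_ge0 _ _ (fun j => Rabs_pos _)).
by rewrite /=; lra.
Qed.

Lemma quad_scale A c v : quad A (vscale c v) = c * c * quad A v.
Proof.
rewrite /quad -bigR_scale; apply: eq_bigr => i _.
by rewrite -bigR_scale; apply: eq_bigr => j _; rewrite /vscale; ring.
Qed.

(* Finsler's lemma. *)
Lemma quad_penalty A b :
  (forall v, v <> vzero -> dot b v = 0 -> 0 < quad A v) ->
  exists lam kap, 0 < lam /\ 0 < kap /\
    forall v, kap * (enorm v * enorm v) <= quad A v + lam * (dot b v * dot b v).
Proof.
move=> hpos; apply: NNPP => hn.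
(* Failure of lam = k + 1 and kap = 1/(k + 1) yields, by homogeneity, a unit vector violating the
   inequality. A cluster point l of these vectors will be a unit vector contradicting positivity on
   the hyperplane. *)
have bad (k : nat) : exists u, enorm u = 1 /\
    quad A u + (INR k + 1) * (dot b u * dot b u) < / (INR k + 1).
  apply: NNPP => hk; apply: hn.
  have k0 : 0 < INR k + 1 by have := pos_INR k; lra.
  exists (INR k + 1), (/ (INR k + 1)); split=> //; split; first exact: Rinv_0_lt_compat.
  move=> v; case: (classic (v = vzero)) => [->|nv].
    have -> : @vzero N = vscale 0 vzero by vring.
    by rewrite enorm_scale dotZr quad_scale Rabs_R0; right; ring.
  have v0 := enorm_gt0 v nv; set u := vscale (/ enorm v) v.
  have vE : v = vscale (enorm v) u by rewrite /u; vfield; lra.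
  have u1 : enorm u = 1.
    by rewrite /u enorm_scale Rabs_pos_eq ?Rinv_l; [|lra|apply: Rlt_le; apply: Rinv_0_lt_compat].
  have hu : / (INR k + 1) <= quad A u + (INR k + 1) * (dot b u * dot b u).
    by case: (Rle_lt_dec (/ (INR k + 1)) (quad A u + (INR k + 1) * (dot b u * dot b u))) => // ?;
       case: hk; exists u.
  rewrite [X in quad A X]vE quad_scale [X in dot b X]vE dotZr.
  have := Rmult_le_compat_l (enorm v * enorm v) _ _ ltac:(nra) hu.
  by lra.
pose u k := proj1_sig (constructive_indefinite_description _ (bad k)).
have hu k : enorm (u k) = 1 /\ quad A (u k) + (INR k + 1) * (dot b (u k) * dot b (u k)) < / (INR k + 1).
  by rewrite /u; case: constructive_indefinite_description.
have [l hl] := bounded_cluster u 1 (fun k => ltac:(rewrite (proj1 (hu k)); lra)).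
have [c [c0 hc]] := entries_bounded A.
have N0 := pos_INR N.
have l1 : enorm l = 1.
  have tri (x y : pt N) : enorm x <= enorm y + enorm (vsub x y).
    have {1}-> : x = vadd y (vsub x y) by vring.
    exact: enormD.
  apply: Rle_antisym; apply: (le_epsilon_mul _ _ 1); try lra; move=> e e0;
    have [k [_ hk]] := hl e e0 0%nat; have := proj1 (hu k).
    by have := tri l (u k); rewrite enorm_subC; lra.
  by have := tri (u k) l; lra.
have near e : 0 < e -> exists k : nat, / (INR k + 1) < e /\ enorm (vsub (u k) l) < e.
  move=> e0; have [K [hK K0]] := archimed_cor1 e e0.
  have [k [Kk hk]] := hl e e0 K; exists k; split=> //.
  apply: Rlt_trans hK; apply: Rinv_lt_contravar.
    by apply: Rmult_lt_0_compat; [exact: lt_0_INR | have := pos_INR k; lra].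
  by have := le_INR _ _ Kk; lra.
have cN : 0 <= INR N * INR N * c.
  by apply: Rmult_le_pos; [apply: Rmult_le_pos | lra].
(* The bounded form forces (k + 1) (b.u_k)^2 to stay bounded. If b.l were nonzero, k large would
   give (b.u_k)^2 < (b.l)^2 / 8, while closeness of u_k to l gives |b.u_k| >= 3/4 |b.l|. *)
have bl : dot b l = 0.
  have b0 := enorm_ge0 b.
  set C := 1 + INR N * INR N * c.
  apply: NNPP => nb.
  have pb : 0 < dot b l * dot b l by nra.
  have [k [hk1 hk2]] := near (Rmin (Rmin 1 (dot b l * dot b l / (8 * C))) (Rabs (dot b l) / (4 * (enorm b + 1))))
    ltac:(apply: Rmin_pos; first (apply: Rmin_pos; first lra; apply: Rdiv_lt_0_compat => //; rewrite /C; lra);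
          apply: Rdiv_lt_0_compat; [exact: Rabs_pos_lt | lra]).
  have := Rlt_le_trans _ _ _ hk1 (Rmin_l _ _) => hk3.
  have hk4 := Rlt_le_trans _ _ _ hk3 (Rmin_l _ _).
  have hk5 := Rlt_le_trans _ _ _ hk3 (Rmin_r _ _).
  have hk6 := Rlt_le_trans _ _ _ hk2 (Rmin_r _ _).
  have [uk1 uk2] := hu k.
  have := quad_le A (u k) c ltac:(lra) hc; rewrite uk1 !Rmult_1_r => hq.
  have kp : 0 < INR k + 1 by have := pos_INR k; lra.
  have sq : dot b (u k) * dot b (u k) < dot b l * dot b l / 8.
    have h1 : (INR k + 1) * (dot b (u k) * dot b (u k)) < C.
      by have := Rabs_le_inv _ _ hq; rewrite /C; lra.
    have h2 : dot b (u k) * dot b (u k) < C * / (INR k + 1).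
      apply: (Rmult_lt_reg_l (INR k + 1)) => //.
      by have -> : (INR k + 1) * (C * / (INR k + 1)) = C by field; lra.
    have C0 : 0 < C by rewrite /C; lra.
    have h3 := Rmult_lt_compat_l C _ _ C0 hk5.
    have h4 : C * (dot b l * dot b l / (8 * C)) = dot b l * dot b l / 8 by field; lra.
    by lra.
  have hd : Rabs (dot b l - dot b (u k)) <= Rabs (dot b l) / 4.
    rewrite -dotBr; apply: Rle_trans (dot_le _ _) _; rewrite enorm_subC.
    have h3 := Rmult_le_compat_l (enorm b + 1) _ _ ltac:(lra) (Rlt_le _ _ hk6).
    have h4 : (enorm b + 1) * (Rabs (dot b l) / (4 * (enorm b + 1))) = Rabs (dot b l) / 4 by field; lra.
    by have := enorm_ge0 (vsub (u k) l); nra.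
  move: hd sq; set x := dot b l; set y := dot b (u k).
  rewrite /Rabs; case: (Rcase_abs x) => ?; case: Rcase_abs => ? *; nra.
have ql : 0 < quad A l.
  by apply: hpos => // l0; move: l1; rewrite l0 enorm_vzero; lra.
(* C - 1 is a Lipschitz constant of the form between unit vectors; with k large, quad A l <= quad A
   u_k + (C - 1) e < C e = quad A l / 2, a contradiction. *)
set C := 1 + INR N * INR N * c * 2.
have [k [hk1 hk2]] := near (quad A l / (2 * C)) ltac:(apply: Rdiv_lt_0_compat => //; rewrite /C; lra).
have [uk1 uk2] := hu k.
have := quad_lip A (u k) l c ltac:(lra) hc; rewrite uk1 l1 => hq.
have h1 : Rabs (quad A (u k) - quad A l) <= (C - 1) * enorm (vsub (u k) l).
  by rewrite /C; lra.
have h2 : quad A (u k) < / (INR k + 1).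
  have : 0 <= (INR k + 1) * (dot b (u k) * dot b (u k)).
    by have := pos_INR k; nra.
  by lra.
have h3 : C * (quad A l / (2 * C)) = quad A l / 2 by field; rewrite /C; lra.
have C1 : 1 <= C by rewrite /C; lra.
have := Rabs_le_inv _ _ h1.
set e := quad A l / (2 * C) in hk1 hk2 h3.
have := Rmult_le_compat_l (C - 1) _ _ ltac:(lra) (Rlt_le _ _ hk2).
by lra.
Qed.

End QuadraticForms.

Lemma fin_near {N : nat} {I : finType} (x0 : pt N) (P : I -> pt N -> Prop) :
  (forall i, exists d, 0 < d /\ forall y, enorm (vsub y x0) < d -> P i y) ->
  exists d, 0 < d /\ forall i y, enorm (vsub y x0) < d -> P i y.
Proof.
move=> h.
suff [d [d0 hd]] : exists d, 0 < d /\
    forall i y, i \in enum I -> enorm (vsub y x0) < d -> P i y.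
  by exists d; split=> // i y hy; apply: hd => //; rewrite mem_enum.
elim: (enum I) => [|i s [d [d0 hd]]]; first by exists 1; split=> //; lra.
have [d' [d'0 hd']] := h i.
exists (Rmin d d'); split; first exact: Rmin_pos.
move=> j y; rewrite inE => /orP [/eqP ->|js] hy.
  by apply: hd'; apply: Rlt_le_trans hy (Rmin_r _ _).
by apply: hd => //; apply: Rlt_le_trans hy (Rmin_l _ _).
Qed.

Lemma cont_on_near {N : nat} (f : pt N -> R) (W : pt N -> Prop) x0 e :
  cont_on f W -> W x0 -> 0 < e ->
  exists d, 0 < d /\ forall y, enorm (vsub y x0) < d -> Rabs (f y - f x0) <= e.
Proof.
move=> hf hx he; have [d [d0 hd]] := hf x0 hx e he.
by exists d; split=> // y /hd; lra.
Qed.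

Section LocalDefiningFunction.
Context {N : nat} (U : pt N -> Prop).
Hypothesis Ubdry : C3_pos_curv_boundary U.

(** The boundary condition in the shape both ball lemmas consume: nonzero gradient and tangential
    positivity at x0 alone, Taylor's formula, and one modulus of continuity at x0 for all first and
    second derivatives. Information at nearby boundary points is recovered through this modulus. *)
Lemma bdry_local x0 : bdry U x0 ->
  exists (F : pt N -> R) (g : 'I_N -> pt N -> R) (H : 'I_N -> 'I_N -> pt N -> R) (r : R),
    0 < r /\
    (forall x, eball x0 r x -> (U x <-> F x < 0)) /\
    (forall x, eball x0 r x -> bdry U x -> F x = 0) /\
    (exists i, g i x0 <> 0) /\
    (forall v, v <> vzero -> dot (fun i => g i x0) v = 0 -> 0 < quad (fun i j => H i j x0) v) /\
    (forall x v, eball x0 r x -> eball x0 r (vadd x v) ->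
      exists xi, 0 < xi < 1 /\ F (vadd x v) = F x + dot (fun i => g i x) v +
        / 2 * quad (fun i j => H i j (vadd x (vscale xi v))) v) /\
    (forall e, 0 < e -> exists d, 0 < d /\ d <= r /\ forall y, eball x0 d y ->
      (forall i, Rabs (g i y - g i x0) <= e) /\
      (forall i j, Rabs (H i j y - H i j x0) <= e)).
Proof.
move=> hx0; have [r [r0 [F [[Fc [g [hg Cg]]] [FU [Fb Fg]]]]]] := Ubdry x0 hx0.
have Hex i : exists H : 'I_N -> pt N -> R,
    (forall j x, eball x0 r x -> has_partial (g i) j x (H j x)) /\
    (forall j, cont_on (H j) (eball x0 r)).
  have [_ [H [hH CH]]] := Cg i.
  by exists H; split=> // j; case: (CH j).
pose H i := proj1_sig (constructive_indefinite_description _ (Hex i)).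
have HP i : (forall j x, eball x0 r x -> has_partial (g i) j x (H i j x)) /\
    (forall j, cont_on (H i j) (eball x0 r)).
  exact: proj2_sig (constructive_indefinite_description _ (Hex i)).
have hH i := proj1 (HP i); have cH i := proj2 (HP i).
have cg i : cont_on (g i) (eball x0 r) by case: (Cg i).
have bx0 : eball x0 r x0 by apply: eball_center.
have [grad0 posd] := Fg g hg.
exists F, g, H, r; split=> //; split=> //; split; first by move=> x hx /(Fb x hx).
split; first by exact: (grad0 x0 bx0).
split.
  move=> v nv hv; apply: (posd x0 bx0 hx0 v) => //; last by move=> i j; apply: hH.
  apply: NNPP => hn; apply: nv; apply: functional_extensionality => i.
  by apply: NNPP => ni; apply: hn; exists i.
split; first by move=> x v hx hv; exact: (taylor2 F g H x0 r x v hg cg hH cH hx hv).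
move=> e e0.
have [d1 [d10 hd1]] := fin_near x0 (fun i y => Rabs (g i y - g i x0) <= e)
  (fun i => cont_on_near _ _ x0 e (cg i) bx0 e0).
have [d2 [d20 hd2]] := fin_near x0 (fun (ij : 'I_N * 'I_N) y => Rabs (H ij.1 ij.2 y - H ij.1 ij.2 x0) <= e)
  (fun ij => cont_on_near _ _ x0 e (cH ij.1 ij.2) bx0 e0).
exists (Rmin r (Rmin d1 d2)); split; first by do 2?apply: Rmin_pos.
split; first exact: Rmin_l.
move=> y hy; have hy2 := Rlt_le_trans _ _ _ hy (Rmin_r _ _).
split=> [i|i j]; first by apply: hd1; apply: Rlt_le_trans hy2 (Rmin_l _ _).
by apply: (hd2 (i, j)); apply: Rlt_le_trans hy2 (Rmin_r _ _).
Qed.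

End LocalDefiningFunction.

(** * Inner and outer tangent balls *)

Lemma enorm_unit {N} (u : pt N) : 0 < enorm u -> enorm (vscale (/ enorm u) u) = 1.
Proof.
move=> h; rewrite enorm_scale Rabs_pos_eq ?Rinv_l //; first by lra.
by apply: Rlt_le; apply: Rinv_0_lt_compat.
Qed.

(** The vector n plays the outward normal: the open ball is centred at x - rho n and has x on its
    boundary. P is U itself or the sublevel set of the gauge. *)
Definition inner_ball {N} (P : pt N -> Prop) (x : pt N) (rho : R) : Prop :=
  exists n : pt N, enorm n = 1 /\
    forall y, enorm (vadd (vsub y x) (vscale rho n)) < rho -> P y.

Lemma inner_ball_shrink {N} (P : pt N -> Prop) x rho rho' :
  rho' <= rho -> inner_ball P x rho -> inner_ball P x rho'.
Proof.
move=> h [n [n1 hn]]; exists n; split=> // y hy; apply: hn.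
have -> : vadd (vsub y x) (vscale rho n) =
  vadd (vadd (vsub y x) (vscale rho' n)) (vscale (rho - rho') n) by vring.
apply: Rle_lt_trans (enormD _ _) _; rewrite enorm_scale n1 Rabs_pos_eq; lra.
Qed.

(** Squaring turns membership in a tangent ball into a comparison of the square of v with its normal
    component, the form that Taylor expansions produce. *)
Lemma ball_halfspace {N} (v n : pt N) rho : enorm n = 1 ->
  enorm (vadd v (vscale rho n)) < rho <-> 0 < rho /\ dot v v + 2 * rho * dot n v < 0.
Proof.
move=> n1.
have e : enorm (vadd v (vscale rho n)) * enorm (vadd v (vscale rho n)) =
    dot v v + 2 * rho * dot n v + rho * rho.
  rewrite enorm_sqr dotDl !dotDr !dotZl !dotZr (dotC v n).
  by have := enorm_sqr n; rewrite n1; nra.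
have := enorm_ge0 (vadd v (vscale rho n)).
split; first by nra.
by move=> [? ?]; nra.
Qed.

Section TangentBalls.
Context {N : nat} {U : pt N -> Prop}.
Hypothesis Uopen : is_open U.
Hypothesis Ubounded : is_bounded U.
Hypothesis Ubdry : C3_pos_curv_boundary U.

(** In the ball, |v|^2 < -2 rho n.v, so the negative linear term |grad F| n.v outweighs the bounded
    quadratic remainder once rho is small against gradient over Hessian. *)
Lemma inner_ball_local x0 : bdry U x0 -> exists d rho, 0 < d /\ 0 < rho /\
  forall x, bdry U x -> enorm (vsub x x0) < d -> inner_ball U x rho.
Proof.
move=> /(bdry_local U Ubdry) [F [g [H [r [r0 [FU [Fb [[i0 gi0] [_ [tay near]]]]]]]]]].
set m := Rabs (g i0 x0) / 2.
have m0 : 0 < m by have := Rabs_pos_lt _ gi0; rewrite /m; lra.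
have [K [K0 hK]] := entries_bounded (fun i j => H i j x0).
have [d [d0 [dr hd]]] := near (Rmin 1 m) ltac:(apply: Rmin_pos; lra).
have N0 := pos_INR N.
set C := INR N * INR N * (K + 1).
have C0 : 0 <= C by rewrite /C; apply: Rmult_le_pos; [apply: Rmult_le_pos | lra].
(* The bound d/4 keeps a ball of diameter 2 rho inside the neighbourhood of x0; m bounds the
   gradient from below there and C the quadratic form from above. *)
set rho := Rmin (d / 4) (m / (C + 1)).
have rho0 : 0 < rho by apply: Rmin_pos; first lra; apply: Rdiv_lt_0_compat; lra.
have rhod : rho <= d / 4 by apply: Rmin_l.
have rhoC : rho * (C + 1) <= m.
  have := Rmult_le_compat_r (C + 1) _ _ ltac:(lra) (Rmin_r (d / 4) (m / (C + 1))).
  have -> : m / (C + 1) * (C + 1) = m by field; lra.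
  by [].
exists (d / 2), rho; split; first lra; split=> // x bx hx.
pose G := (fun i => g i x) : pt N.
have xd : eball x0 d x by rewrite /eball; lra.
have xr : eball x0 r x by rewrite /eball in xd *; lra.
have Gm : m <= enorm G.
  have := coord_le G i0; have := proj1 (hd x xd) i0; have := Rmin_r 1 m.
  have := Rabs_triang_inv (g i0 x0) (g i0 x).
  by rewrite /G (Rabs_minus_sym (g i0 x)) /m; lra.
have n1 := enorm_unit G ltac:(lra).
set n := vscale _ G in n1.
exists n; split=> // y; set v := vsub y x => hv.
have /(ball_halfspace _ _ _ n1) [_ hs] := hv.
have vrho : enorm v < d / 2.
  have -> : v = vsub (vadd v (vscale rho n)) (vscale rho n) by vring.
  apply: Rle_lt_trans (enormB _ _) _.
  by rewrite enorm_scale n1 Rabs_pos_eq; lra.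
have yE : y = vadd x v by rewrite /v; vring.
have seg s : 0 <= s <= 1 -> eball x0 d (vadd x (vscale s v)).
  move=> hs'; rewrite /eball; have := enorm_triangle x (vadd x (vscale s v)) x0.
  have -> : vsub (vadd x (vscale s v)) x = vscale s v by vring.
  by rewrite enorm_scale Rabs_pos_eq; have := enorm_ge0 v; nra.
have yd : eball x0 d (vadd x v).
  by have := seg 1 ltac:(lra); have -> : vscale 1 v = v by vring.
have yr : eball x0 r (vadd x v) by rewrite /eball in yd *; lra.
rewrite yE; apply/(FU _ yr).
have [xi [hxi ->]] := tay x v xr yr.
rewrite (Fb x xr bx).
have -> : dot (g^~ x) v = enorm G * dot n v.
  by rewrite /n dotZl -Rmult_assoc Rinv_r; [ring_simplify | lra].
have hq : Rabs (quad (fun i j => H i j (vadd x (vscale xi v))) v) <= C * dot v v.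
  rewrite -enorm_sqr; apply: quad_le; first by lra.
  move=> i j; have := proj2 (hd _ (seg xi ltac:(lra))) i j; have := Rmin_l 1 m; have := hK i j.
  have := Rabs_triang (H i j (vadd x (vscale xi v)) - H i j x0) (H i j x0).
  by rewrite Rplus_assoc Rplus_opp_l Rplus_0_r; lra.
have := Rabs_le_inv _ _ hq.
set q := quad _ _; have := dot_ge0 v; set a := dot v v in hs *; set b := dot n v in hs *.
move=> a0 [_ hqa].
have b0 : b < 0 by nra.
have h1 : enorm G * b <= m * b by nra.
apply: (Rmult_lt_reg_l (2 * rho)); first by lra.
by nra.
Qed.

(** Boundary points failing for the radii 1/(k + 1) would cluster at a point of the closed boundary;
    the local radius there serves its neighbours and shrinks to any smaller radius. *)
Lemma inner_ball_uniform : exists rho, 0 < rho /\ forall x, bdry U x -> inner_ball U x rho.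
Proof.
apply: NNPP => hn.
have bad (k : nat) : exists x, bdry U x /\ ~ inner_ball U x (/ (INR k + 1)).
  apply: NNPP => hk; apply: hn; exists (/ (INR k + 1)); split.
    by apply: Rinv_0_lt_compat; have := pos_INR k; lra.
  by move=> x bx; apply: NNPP => nx; apply: hk; exists x.
pose x k := proj1_sig (constructive_indefinite_description _ (bad k)).
have hx k : bdry U (x k) /\ ~ inner_ball U (x k) (/ (INR k + 1)).
  exact: proj2_sig (constructive_indefinite_description _ (bad k)).
have [B hB] := Ubounded.
have xB k : enorm (x k) <= B + 1.
  have [[hcl _] _] := hx k; have [y [Uy hy]] := hcl 1 ltac:(lra).
  have {1}-> : x k = vsub y (vsub y (x k)) by vring.
  by have := enormB y (vsub y (x k)); have := hB y Uy; lra.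
have [l hl] := bounded_cluster x (B + 1) xB.
have bl : bdry U l.
  split.
    move=> e e0; have [k [_ hk]] := hl (e / 2) ltac:(lra) 0%nat.
    have [[hcl _] _] := hx k; have [y [Uy hy]] := hcl (e / 2) ltac:(lra).
    by exists y; split=> //; have := enorm_triangle (x k) y l; lra.
  move=> /Uopen [e [e0 he]]; have [k [_ hk]] := hl e e0 0%nat.
  by have [[_ nU] _] := hx k; apply: nU; apply: he.
have [d [rho [d0 [rho0 hloc]]]] := inner_ball_local l bl.
have [K [hK K0]] := archimed_cor1 rho rho0.
have [k [Kk hk]] := hl d d0 K.
have [bk nk] := hx k; apply: nk.
apply: inner_ball_shrink (hloc _ bk hk).
apply: Rlt_le; apply: Rlt_trans hK; apply: Rinv_lt_contravar.
  by apply: Rmult_lt_0_compat; [exact: lt_0_INR | have := pos_INR k; lra].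
by have := le_INR _ _ Kk; lra.
Qed.

(* For [y = x + v] in the closure of [U], Taylor's formula and [quad_penalty] give
   [0 >= F y >= l + k |v|^2 - lam l^2] with [l] the linear term. *)
Lemma outer_ball_local x0 : bdry U x0 -> exists d kap, 0 < d /\ 0 < kap /\
  forall x, bdry U x -> enorm (vsub x x0) < d -> exists n, enorm n = 1 /\
    forall y, U y \/ bdry U y -> enorm (vsub y x0) < d ->
      dot n (vsub y x) <= - kap * dot (vsub y x) (vsub y x).
Proof.
move=> /(bdry_local U Ubdry) [F [g [H [r [r0 [FU [Fb [[i0 gi0] [posd [tay near]]]]]]]]]].
pose G0 := (fun i => g i x0) : pt N.
have [lam [kap [lam0 [kap0 hpen]]]] := quad_penalty _ G0 posd.
set m := Rabs (g i0 x0) / 2.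
have m0 : 0 < m by have := Rabs_pos_lt _ gi0; rewrite /m; lra.
have N0 := pos_INR N.
have NN0 : 0 <= INR N * INR N by nra.
set C := INR N * INR N * (1 + 2 * lam) + 1.
have C1 : 1 <= C by rewrite /C; nra.
(* The bound m keeps the gradient at x of norm at least m, 1 keeps it below B, and kap / (2 C) lets
   half of the penalized positivity at x0 absorb the changes of Hessian and gradient between x0 and
   x. *)
set e := Rmin (Rmin 1 m) (kap / (2 * C)).
have e0 : 0 < e by do 2?apply: Rmin_pos; try lra; apply: Rdiv_lt_0_compat; lra.
have e1 : e <= 1 by apply: Rle_trans (Rmin_l _ _) (Rmin_l _ _).
have em : e <= m by apply: Rle_trans (Rmin_l _ _) (Rmin_r _ _).
have eC : e * C <= kap / 2.
  have := Rmult_le_compat_r C _ _ ltac:(lra) (Rmin_r (Rmin 1 m) (kap / (2 * C))).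
  have -> : kap / (2 * C) * C = kap / 2 by field; lra.
  by [].
have [d [d0 [dr hd]]] := near e e0.
set B := enorm G0 + INR N + 1.
have B0 : 0 < B by have := enorm_ge0 G0; rewrite /B; lra.
(* As |l| <= 2 B d', this makes lam |l| <= 1/4, so the penalty lam l^2 is at most |l|/4 and cannot
   compete with l itself. *)
set d' := Rmin d (/ (8 * lam * B)).
have d'd : d' <= d by apply: Rmin_l.
have d'0 : 0 < d' by apply: Rmin_pos => //; apply: Rinv_0_lt_compat; do 2?apply: Rmult_lt_0_compat; lra.
have d'B : 8 * (lam * (B * d')) <= 1.
  have := Rmult_le_compat_l (8 * lam * B) _ _ ltac:(do 2?apply: Rmult_le_pos; lra)
    (Rmin_r d (/ (8 * lam * B))).
  rewrite -/d' Rinv_r; first by lra.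
  by apply: Rmult_integral_contrapositive_currified; [nra | lra].
exists d', (kap / (6 * B)); split=> //; split; first by apply: Rdiv_lt_0_compat; lra.
move=> x bx hx.
pose G := (fun i => g i x) : pt N.
have xd : eball x0 d x by rewrite /eball; lra.
have xr : eball x0 r x by rewrite /eball in xd *; lra.
have Gm : m <= enorm G.
  have := coord_le G i0; have := proj1 (hd x xd) i0.
  have := Rabs_triang_inv (g i0 x0) (g i0 x).
  by rewrite /G (Rabs_minus_sym (g i0 x)) /m; rewrite /m in em; lra.
have GG0 : enorm (vsub G0 G) <= INR N * e.
  apply: enorm_le_coords; first by lra.
  by move=> i; rewrite /vsub Rabs_minus_sym; apply: (proj1 (hd x xd)).
have GB : enorm G <= B.
  have {1}-> : G = vsub G0 (vsub G0 G) by vring.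
  apply: Rle_trans (enormB _ _) _; rewrite /B; nra.
have n1 := enorm_unit G ltac:(lra).
set n := vscale _ G in n1.
exists n; split=> // y hy yd'; set v := vsub y x.
have yE : y = vadd x v by rewrite /v; vring.
have yr : eball x0 r (vadd x v) by rewrite -yE /eball; lra.
have Fy : F (vadd x v) <= 0.
  rewrite -yE in yr *; case: hy => [/(FU _ yr)|/(Fb _ yr) ->]; lra.
have [xi [hxi]] := tay x v xr yr; rewrite (Fb x xr bx) -/G => Fe.
rewrite Fe in Fy.
have zd : eball x0 d (vadd x (vscale xi v)).
  by apply: eball_segment => //; [rewrite -yE /eball; lra | lra].
have hq := quad_sub_le (fun i j => H i j (vadd x (vscale xi v))) (fun i j => H i j x0) v e
  ltac:(lra) (proj2 (hd _ zd)).
have := Rabs_le_inv _ _ hq; have := hpen v.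
have vb : enorm v <= 2 * d'.
  by have := enorm_triangle x0 y x; rewrite -/v (enorm_subC x0 x); lra.
have lb : Rabs (dot G v) <= B * (2 * d').
  apply: Rle_trans (dot_le _ _) _.
  by apply: Rmult_le_compat => //; exact: enorm_ge0.
have nv : enorm G * dot n v = dot G v.
  by rewrite /n dotZl -Rmult_assoc Rinv_r; [ring_simplify | lra].
have l0 : dot G0 v * dot G0 v <= 2 * (dot G v * dot G v) + 2 * (INR N * INR N * e * (enorm v * enorm v)).
  have hdiff : Rabs (dot G0 v - dot G v) <= INR N * e * enorm v.
    rewrite -dotBl; apply: Rle_trans (dot_le _ _) _.
    by apply: Rmult_le_compat_r => //; exact: enorm_ge0.
  have := Rabs_le_inv _ _ hdiff; have v0 := enorm_ge0 v.
  set a := dot G0 v; set b := dot G v; set c := INR N * e * enorm v => hc.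
  have h1 : (a - b) * (a - b) <= c * c by nra.
  have h2 : c * c <= INR N * INR N * e * (enorm v * enorm v).
    have -> : c * c = INR N * INR N * (enorm v * enorm v) * (e * e) by rewrite /c; ring.
    have -> : INR N * INR N * e * (enorm v * enorm v) = INR N * INR N * (enorm v * enorm v) * e by ring.
    by apply: Rmult_le_compat_l; [apply: Rmult_le_pos => //; nra | nra].
  by have := Rle_0_sqr (a - 2 * b); rewrite /Rsqr; lra.
move: Fy l0 nv (Rabs_le_inv _ _ lb); rewrite -enorm_sqr.
set l := dot G v; set q := quad _ v; set q0 := quad _ v; set l0 := dot G0 v.
set s := enorm v * enorm v; set t := dot n v => Fy hl0 nv hl hp [hq1 _].
have s0 : 0 <= s by rewrite /s; have := enorm_ge0 v; nra.
have q_ge : kap / 2 * s - 2 * lam * (l * l) <= q.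
  have h1 : lam * (l0 * l0) <= lam * (2 * (l * l) + 2 * (INR N * INR N * e * s)) by apply: Rmult_le_compat_l; lra.
  have h2 : e * C * s <= kap / 2 * s by apply: Rmult_le_compat_r.
  have h3 : 0 <= e * s by nra.
  have -> : kap / 2 * s = kap * s - kap / 2 * s by field.
  have h4 : e * C * s = INR N * INR N * e * s + lam * (2 * (INR N * INR N * e * s)) + e * s.
    by rewrite /C; ring.
  by lra.
have ll : lam * (l * l) <= / 4 * Rabs l.
  have h1 : lam * Rabs l <= / 4.
    by have := Rmult_le_compat_l lam _ _ (Rlt_le _ _ lam0) lb; rewrite -/l; lra.
  have h2 : l * l = Rabs l * Rabs l by rewrite -Rabs_mult Rabs_pos_eq //; nra.
  by rewrite h2 -Rmult_assoc; apply: Rmult_le_compat_r => //; exact: Rabs_pos.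
(* The inequality F <= 0 now reads l + kap s / 4 <= lam l^2 <= |l| / 4, which excludes l > 0 and
   even gives l <= - kap s / 5. *)
have main : l <= - (kap / 6) * s.
  have ks : 0 <= kap * s by nra.
  by move: ll; rewrite /Rabs; case: Rcase_abs => ? ?; nra.
have -> : - (kap / (6 * B)) * s = - ((kap / 6) * s) / B by field; lra.
apply: (Rmult_le_reg_l B) => //.
have -> : B * (- (kap / 6 * s) / B) = - (kap / 6 * s) by field; lra.
have t0 : t <= 0.
  have ks : 0 <= kap / 6 * s by nra.
  case: (Rle_lt_dec t 0) => // tp.
  by have := Rmult_lt_0_compat (enorm G) t ltac:(lra) tp; lra.
by have := Rmult_le_compat_neg_l t _ _ t0 GB; lra.
Qed.

End TangentBalls.

(** * Distances on Hilbert spheres *)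

Lemma ln_le_sub1 x : 0 < x -> ln x <= x - 1.
Proof. by move=> x0; have := exp_ineq1_le (ln x); rewrite exp_ln; lra. Qed.

Lemma exp_le_linear x : 0 <= x <= 1 -> exp x <= 1 + 3 * x.
Proof.
move=> hx; have := exp_ineq1_le (- x); have : exp x * exp (- x) = 1 by rewrite -exp_plus Rplus_opp_r exp_0.
have := exp_pos x; have : exp x <= 3.
  apply: Rle_trans exp_le_3; case: (Rle_lt_or_eq_dec x 1 ltac:(lra)) => [h|->]; last by lra.
  by apply: Rlt_le; apply: exp_increasing.
by move=> *; nra.
Qed.

(** The distance splits into one positive term per end of the chord: both ends must be far for an
    upper bound, a single near end suffices for a lower bound. *)
Lemma cross_logE s1 s2 : s1 < 0 -> 1 < s2 ->
  cross_log s1 s2 = / 2 * (ln (1 + / - s1) + ln (1 + / (s2 - 1))).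
Proof.
move=> h1 h2; have i1 : 0 < / - s1 by apply: Rinv_0_lt_compat; lra.
have i2 : 0 < / (s2 - 1) by apply: Rinv_0_lt_compat; lra.
rewrite -ln_mult; try lra.
by rewrite /cross_log; congr (_ * ln _); field; lra.
Qed.

Lemma cross_log_le s1 s2 sg : 2 <= sg -> s1 <= - sg -> sg <= s2 ->
  cross_log s1 s2 <= 3 / 2 * / sg.
Proof.
move=> h h1 h2; rewrite cross_logE; try lra.
have i1 : 0 < / - s1 by apply: Rinv_0_lt_compat; lra.
have i2 : 0 < / (s2 - 1) by apply: Rinv_0_lt_compat; lra.
have := ln_le_sub1 (1 + / - s1) ltac:(lra); have := ln_le_sub1 (1 + / (s2 - 1)) ltac:(lra).
have : / - s1 <= / sg by apply: Rinv_le_contravar; lra.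
have : / (s2 - 1) <= / (sg / 2) by apply: Rinv_le_contravar; lra.
have -> : / (sg / 2) = 2 * / sg by field; lra.
by lra.
Qed.

(** A distance of at most 1/2 keeps each ln (1 + a) in [0, 1], where a <= 3 ln (1 + a); the factor 6
    includes the half in [cross_log]. *)
Lemma cross_log_ge s1 s2 tau : s1 < 0 -> 1 < s2 -> cross_log s1 s2 <= 1 / 2 ->
  s2 - 1 <= tau \/ - s1 <= tau -> 0 < tau -> / tau <= 6 * cross_log s1 s2.
Proof.
move=> h1 h2; rewrite cross_logE //.
have i1 : 0 < / - s1 by apply: Rinv_0_lt_compat; lra.
have i2 : 0 < / (s2 - 1) by apply: Rinv_0_lt_compat; lra.
have lnp x : 0 < x -> 0 < ln (1 + x) by move=> x0; rewrite -ln_1; apply: ln_increasing; lra.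
have key a b : 0 < a -> / 2 * (ln (1 + a) + b) <= 1 / 2 -> 0 < b -> a <= 6 * (/ 2 * (ln (1 + a) + b)).
  move=> a0 hle b0; have := exp_le_linear (ln (1 + a)).
  by rewrite exp_ln; have := lnp a a0; lra.
move=> hd [] ht t0.
  have : / tau <= / (s2 - 1) by apply: Rinv_le_contravar; lra.
  have := key _ (ln (1 + / - s1)) i2 ltac:(lra) (lnp _ i1); lra.
have : / tau <= / - s1 by apply: Rinv_le_contravar; lra.
have := key _ (ln (1 + / (s2 - 1))) i1 ltac:(lra) (lnp _ i2); lra.
Qed.

(** * Metric spheres in gauge form and the two comparisons of distances on them *)

Section HilbertSphere.
Context {N : nat} {U : pt N -> Prop} {o : pt N} {g : pt N -> R} {L M : R}.
Hypothesis hg : is_gauge U o g L M.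

Let L0 : 0 < L := gauge_L _ _ _ _ _ hg.
Let M0 : 0 < M := gauge_M _ _ _ _ _ hg.
Let gZ := gauge_scale _ _ _ _ _ hg.

(** The cross-ratio equation 1 - g p = e^2 (1 + g (-p)) without fractions; its left side is
    sublinear in p, which makes the sphere a radial graph. *)
Definition on_sphere (e : R) (p : pt N) : Prop := g p + e * e * g (vopp p) = 1 - e * e.

(** On the line from o through o + p the ends of the chord have parameters -1/g (-p) and 1/g p, so
    the cross-ratio depends only on these two gauge values. *)
Lemma hsphere_gauge t p : 0 < t -> hsphere U o t (vadd o p) <-> on_sphere (exp (- t)) p.
Proof.
move=> t0; rewrite /on_sphere -exp_plus; set E := exp _.
have E0 : 0 < E by apply: exp_pos.
have E1 : E < 1 by rewrite -exp_0; apply: exp_increasing; lra.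
have oE : o = vadd o vzero by vring.
have gs s : g (vadd vzero (vscale s (vsub p vzero))) = g (vscale s p).
  by congr g; vring.
have gneg s : s <= 0 -> g (vscale s p) = - s * g (vopp p).
  by move=> s0; rewrite -gZ; [congr g; vring | lra].
have inv : / E = exp (2 * t) by rewrite /E -exp_Ropp; congr exp; lra.
have a0 := gauge_ge0 hg p; have b0 := gauge_ge0 hg (vopp p).
have opp_gt0 : p <> vzero -> 0 < g (vopp p).
  move=> np; apply: (gauge_gt0 hg) => h; apply: np.
  have -> : p = vopp (vopp p) by vring.
  by rewrite h; vring.
have cross a b : 0 < a < 1 -> 0 < b ->
    cross_log (- / b) (/ a) = / 2 * ln ((1 + b) / (1 - a)).
  move=> ha hb; rewrite /cross_log; congr (_ * ln _).
  by field; split; first lra; split; lra.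
split.
  move=> [/(gauge_in _ _ _ _ _ hg) gp1 hd].
  case: (classic (p = vzero)) => [pz|np].
    case: hd => [[_ e]|[ne _]]; first by lra.
    by case: ne; rewrite pz -oE.
  move: hd; rewrite {1}oE; move/(hdist_gauge hg vzero p t (fun e => np (esym e)) ltac:(rewrite (gauge_vzero hg); lra) gp1).
  move=> [s1 [s2 [h1 [h2 []]]]]; rewrite !gs (gneg s1) ?(gZ s2); try lra.
  move=> b1 [b2 te].
  have pb := opp_gt0 np; have pa := gauge_gt0 hg p np.
  have es1 : s1 = - / g (vopp p).
    by apply: (Rmult_eq_reg_r (g (vopp p))); last lra; rewrite Ropp_mult_distr_l_reverse Rinv_l; lra.
  have es2 : s2 = / g p by apply: (Rmult_eq_reg_r (g p)); last lra; rewrite Rinv_l; lra.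
  have q0 : 0 < (1 + g (vopp p)) / (1 - g p) by apply: Rdiv_lt_0_compat; lra.
  have : exp (2 * t) = (1 + g (vopp p)) / (1 - g p).
    rewrite te es1 es2 cross //; try lra.
    rewrite -[RHS]exp_ln //; congr exp; lra.
  rewrite -inv => h.
  have : E * / E * (1 - g p) = E * (1 + g (vopp p)).
    by rewrite Rmult_assoc h; field; lra.
  by rewrite Rinv_r; lra.
move=> h.
have gp1 : g p < 1 by nra.
have np : p <> vzero.
  move=> pz; move: h; rewrite pz.
  have -> : vopp (@vzero N) = vzero by vring.
  by rewrite (gauge_vzero hg); lra.
have pb := opp_gt0 np; have pa := gauge_gt0 hg p np.
split; first exact/(gauge_in _ _ _ _ _ hg).
rewrite {1}oE; apply/(hdist_gauge hg) => //.
- by move=> e; apply: np.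
- by rewrite (gauge_vzero hg); lra.
have ib : 0 < / g (vopp p) by apply: Rinv_0_lt_compat.
have ia : 1 < / g p by rewrite -[X in X < _]Rinv_1; apply: Rinv_lt_contravar; lra.
exists (- / g (vopp p)), (/ g p); rewrite !gs (gneg (- _)) ?(gZ (/ g p)); try lra.
split; first by lra.
split=> //; split; first by rewrite Ropp_involutive Rinv_l; lra.
split; first by rewrite Rinv_l; lra.
rewrite cross //.
have -> : (1 + g (vopp p)) / (1 - g p) = exp (2 * t).
  by rewrite -inv; have -> : 1 - g p = E * (1 + g (vopp p)) by [lra]; field; split; lra.
by rewrite ln_exp; lra.
Qed.

Lemma opp_le p : g p <= 1 -> g (vopp p) <= L * M.
Proof.
move=> gp; apply: Rle_trans (gauge_le _ _ _ _ _ hg _) _.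
apply: Rmult_le_compat_l; first lra.
rewrite enorm_scale Rabs_Ropp Rabs_R1.
by have := gauge_ge _ _ _ _ _ hg p; nra.
Qed.

Lemma on_sphere_depth e p : 0 < e -> on_sphere e p ->
  e * e <= 1 - g p <= (1 + L * M) * (e * e).
Proof.
move=> e0; rewrite /on_sphere => h.
have b0 := gauge_ge0 hg (vopp p).
have gp : g p <= 1 by nra.
by have := opp_le p gp; nra.
Qed.

Lemma radial_bdry p : 0 < g p -> g (vscale (/ g p) p) = 1.
Proof. by move=> h; rewrite gZ; [rewrite Rinv_l; lra | apply: Rlt_le; apply: Rinv_0_lt_compat]. Qed.

(** The hyperplane tangent to an inner ball supports the body. If y lay strictly beyond it, a small
    step from x away from y would enter the ball, and x would lie between a point of gauge below 1
    and a point of gauge at most 1. *)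
Lemma support x n rho : 0 < rho -> enorm n = 1 -> g x = 1 ->
  (forall y, enorm (vadd (vsub y x) (vscale rho n)) < rho -> g y < 1) ->
  forall y, g y <= 1 -> dot n (vsub y x) <= 0.
Proof.
move=> r0 n1 gx hn y gy; set v := vsub y x.
case: (Rle_lt_dec (dot n v) 0) => // b0.
have a0 := dot_ge0 v.
set s := rho * dot n v / (dot v v + 1).
have s0 : 0 < s by apply: Rdiv_lt_0_compat; nra.
have sE : s * (dot v v + 1) = rho * dot n v by rewrite /s; field; lra.
set z := vadd x (vscale (- s) v).
have gz : g z < 1.
  apply: hn; apply/(ball_halfspace _ _ _ n1); split=> //.
  have -> : vsub z x = vscale (- s) v by rewrite /z; vring.
  by rewrite !dotZl !dotZr; nra.
have t0 : 0 < / (1 + s) by apply: Rinv_0_lt_compat; lra.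
have tE : / (1 + s) * (1 + s) = 1 by rewrite Rinv_l; lra.
have := gauge_convex hg z y (s * / (1 + s)) ltac:(split; nra).
have -> : vadd z (vscale (s * / (1 + s)) (vsub y z)) = x.
  by rewrite /z /v; vfield; lra.
rewrite gx => h.
have tE2 : 1 - s * / (1 + s) = / (1 + s) by field; lra.
have := Rmult_lt_compat_l _ _ _ t0 gz.
have := Rmult_le_compat_l (s * / (1 + s)) _ _ ltac:(apply: Rmult_le_pos; lra) gy.
by rewrite tE2 in h; lra.
Qed.

(** The inner ball at the radial projection x of p contains p + s w whenever |s w| <= c e, so both
    ends of the chord through p and q have parameters at least c e / |w| in size. The closeness
    threshold h may depend on e, since the nets to which this is applied can be arbitrarily fine. *)
Lemma sphere_dist_upper rho : 0 < rho ->
  (forall x, g x = 1 -> inner_ball (fun y => g y < 1) x rho) ->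
  exists C e0, 0 < C /\ 0 < e0 /\ forall e, 0 < e < e0 -> exists h, 0 < h /\
    forall p q, on_sphere e p -> on_sphere e q -> p <> q -> enorm (vsub q p) < h ->
      exists d, hdist U (vadd o p) (vadd o q) d /\ d <= C / e * enorm (vsub q p).
Proof.
move=> r0 hball; set D := L * M.
have D0 : 0 < D by apply: Rmult_lt_0_compat.
set C1 := 2 * ((1 + D) * (1 + D)) / rho.
have C10 : 0 < C1 by apply: Rdiv_lt_0_compat; nra.
set C2 := D + C1.
(* The square of a displacement c e contributes 2 c^2 E, at most a quarter of the gain 2 rho E / L
   that the depth of p provides. *)
set c := Rmin 1 (rho / (4 * L)).
have c0 : 0 < c by apply: Rmin_pos; [lra | apply: Rdiv_lt_0_compat; lra].
have c1 : c <= 1 by apply: Rmin_l.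
have cL : c <= rho / (4 * L) by apply: Rmin_r.
(* K gathers the remaining errors of order e E in the ball inequality: the squared depth and the
   normal component of w. The condition e K < rho / L makes them at most half of the gain. *)
set K := 2 * ((1 + D) * (1 + D) * (M * M)) + 2 * rho * C2.
have K0 : 0 < K.
  have : 0 < (1 + D) * (1 + D) * (M * M) by do 2?apply: Rmult_lt_0_compat; lra.
  have : 0 < rho * C2 by apply: Rmult_lt_0_compat; rewrite /C2; lra.
  by rewrite /K; lra.
set e0 := Rmin (/ (2 * (1 + D))) (rho / L / K).
have rL : 0 < rho / L by apply: Rdiv_lt_0_compat.
have e00 : 0 < e0 by apply: Rmin_pos; [apply: Rinv_0_lt_compat; lra | apply: Rdiv_lt_0_compat].
exists (3 / 2 / c), e0; split; first by apply: Rdiv_lt_0_compat; lra.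
split=> // e [ep he].
have eD : e * (1 + D) <= 1 / 2.
  have := Rmult_le_compat_r (2 * (1 + D)) _ _ ltac:(lra) (Rlt_le _ _ (Rlt_le_trans _ _ _ he (Rmin_l _ _))).
  by rewrite Rinv_l; lra.
have e1 : e <= 1 / 2 by nra.
have eK : e * K < rho / L.
  have := Rmult_lt_compat_r K _ _ K0 (Rlt_le_trans _ _ _ he (Rmin_r _ _)).
  have -> : rho / L / K * K = rho / L by field; lra.
  by [].
set E := e * e.
have E0 : 0 < E by apply: Rmult_lt_0_compat.
have Ee : E <= e by rewrite /E; nra.
(* The bound E turns the error |w|^2 into E |w|; the bound c e / 2 makes the parameters of the ends
   at least 2, as [cross_log_le] requires. *)
exists (Rmin E (c * e / 2)); split; first by apply: Rmin_pos => //; nra.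
move=> p q sp sq npq hw; set w := vsub q p in hw *; set om := enorm w in hw *.
have omE : om < E by apply: Rlt_le_trans hw (Rmin_l _ _).
have omc : om < c * e / 2 by apply: Rlt_le_trans hw (Rmin_r _ _).
have nw : w <> vzero by move=> /vsub_eq0 h; apply: npq.
have om0 : 0 < om by apply: enorm_gt0.
have dp := on_sphere_depth e p ep sp; have dq := on_sphere_depth e q ep sq.
rewrite -/E -/D in dp dq.
have half : (1 + D) * E <= 1 / 2 by nra.
have gp : 1 / 2 <= g p < 1 by lra.
have gq : 1 / 2 <= g q < 1 by lra.
set x := vscale (/ g p) p.
have gx : g x = 1 by apply: radial_bdry; lra.
have pE : p = vscale (g p) x by rewrite /x; vfield; lra.
have xM : enorm x <= M by have := gauge_ge _ _ _ _ _ hg x; rewrite gx; lra.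
have [n [n1 hn]] := hball x gx.
have supp := support x n rho r0 n1 gx hn.
set X := dot n x.
have XL : / L <= X.
  (* The point n / L has gauge at most 1, so it lies below the supporting hyperplane at x: that
     hyperplane is at distance at least 1/L from the origin. *)
  have := supp (vscale (/ L) n); rewrite dotBr dotZr -/X -enorm_sqr n1.
  have iL : 0 < / L by apply: Rinv_0_lt_compat.
  rewrite gZ; last by lra.
  have := gauge_le _ _ _ _ _ hg n; rewrite n1 => gn h.
  have : / L * g n <= 1.
    by have := Rmult_le_compat_l (/ L) _ _ ltac:(lra) gn; rewrite Rmult_1_r Rinv_l; lra.
  by move/h; lra.
have XM : X <= M by have := dot_le_norm n x; rewrite n1 -/X; lra.
have X0 : 0 < X by apply: Rlt_le_trans XL; apply: Rinv_0_lt_compat.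
set Dl := g q - g p.
have hDl : Rabs Dl <= E * L * om.
  have -> : Dl = E * (g (vopp p) - g (vopp q)).
    by move: sp sq; rewrite /on_sphere -/E /Dl; lra.
  rewrite Rabs_mult Rabs_pos_eq ?(Rmult_assoc E); last by lra.
  apply: Rmult_le_compat_l; first by lra.
  apply: Rle_trans (gauge_lip hg _ _) _; right; congr (_ * _).
  by rewrite /om /w; congr enorm; vring.
have [Dl1 Dl2] := Rabs_le_inv _ _ hDl.
set W := dot n w.
have nqE : dot n q = g p * X + W.
  have -> : q = vadd p w by rewrite /w; vring.
  by rewrite dotDr [X in dot n X + _]pE dotZr.
set y := vscale (/ g q) q.
have gy : g y = 1 by apply: radial_bdry; lra.
have yxE : dot n (vsub y x) = (W - Dl * X) * / g q.
  by rewrite dotBr dotZr nqE -/X /Dl; field; lra.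
have iq : 1 <= / g q <= 2.
  split; first by rewrite -[X in X <= _]Rinv_1; apply: Rinv_le_contravar; lra.
  have -> : 2 = / (1 / 2) by field.
  by apply: Rinv_le_contravar; lra.
have W_up : W <= Dl * X.
  by have := supp y ltac:(lra); rewrite yxE; nra.
have yx_le : enorm (vsub y x) <= 2 * (1 + D) * om.
  have -> : vsub y x = vscale (/ g q) (vsub w (vscale Dl x)).
    rewrite /y /w {1}pE; apply: functional_extensionality => i.
    by rewrite /Dl /vsub /vscale; field; lra.
  rewrite enorm_scale Rabs_pos_eq; last by lra.
  have h1 : enorm (vsub w (vscale Dl x)) <= (1 + D) * om.
    apply: Rle_trans (enormB _ _) _; rewrite enorm_scale -/om.
    have : Rabs Dl * enorm x <= E * L * om * M.
      by apply: Rmult_le_compat => //; [exact: Rabs_pos | exact: enorm_ge0].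
    have : E * (D * om) <= 1 * (D * om) by apply: Rmult_le_compat_r; nra.
    by rewrite /D; lra.
  by have := enorm_ge0 (vsub w (vscale Dl x)); nra.
(* The radial projection y of q has gauge 1, hence lies outside the open inner ball at x; this
   complements the bound from the supporting hyperplane. *)
have W_lo : - (C1 * (om * om)) <= W - Dl * X.
  have nball : 0 <= dot (vsub y x) (vsub y x) + 2 * rho * dot n (vsub y x).
    case: (Rle_lt_dec 0 (dot (vsub y x) (vsub y x) + 2 * rho * dot n (vsub y x))) => // neg.
    by have := hn y; rewrite gy => h; have := h ltac:(apply/(ball_halfspace _ _ _ n1); split; lra); lra.
  move: nball; rewrite -enorm_sqr yxE => nball.
  have y0 := enorm_ge0 (vsub y x).
  have h1 : enorm (vsub y x) * enorm (vsub y x) <= 2 * rho * (C1 * (om * om)).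
    have -> : 2 * rho * (C1 * (om * om)) = (2 * (1 + D) * om) * (2 * (1 + D) * om).
      by rewrite /C1; field; lra.
    by apply: Rmult_le_compat.
  have h2 : - (C1 * (om * om)) <= (W - Dl * X) * / g q.
    by apply: (Rmult_le_reg_l (2 * rho)); nra.
  have : 0 <= C1 * (om * om) by nra.
  by case: (Rle_lt_dec 0 (W - Dl * X)) => ?; nra.
have hW : Rabs W <= C2 * E * om.
  have hX : Rabs (Dl * X) <= E * D * om.
    rewrite Rabs_mult (Rabs_pos_eq X); last by lra.
    have -> : E * D * om = E * L * om * M by rewrite /D; ring.
    by apply: Rmult_le_compat => //; [exact: Rabs_pos | lra].
  have [h1 h2] := Rabs_le_inv _ _ hX.
  have : C1 * (om * om) <= C1 * (E * om) by apply: Rmult_le_compat_l; nra.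
  have p1 : 0 <= C1 * (E * om) by apply: Rmult_le_pos; nra.
  by move=> h3; apply: Rabs_le; rewrite /C2; lra.
have inside s : Rabs s * om <= c * e -> g (vadd p (vscale s w)) < 1.
  move=> hs; apply: hn; apply/(ball_halfspace _ _ _ n1); split=> //.
  set de := 1 - g p; rewrite -/de in dp.
  have -> : vsub (vadd p (vscale s w)) x = vsub (vscale s w) (vscale de x).
    rewrite {1}pE; apply: functional_extensionality => i.
    by rewrite /vsub /vadd /vscale /de; ring.
  set z := vsub _ _.
  have hz : dot z z <= 2 * (c * c * E) + 2 * ((1 + D) * (1 + D) * (M * M) * (E * E)).
    have : enorm z <= c * e + (1 + D) * E * M.
      apply: Rle_trans (enormB _ _) _; rewrite (enorm_scale s) (enorm_scale de) -/om (Rabs_pos_eq de); last by lra.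
      by have := Rmult_le_compat de ((1 + D) * E) (enorm x) M ltac:(lra) (enorm_ge0 x) ltac:(lra) xM; lra.
    move=> hz; rewrite -enorm_sqr.
    have := Rmult_le_compat _ _ _ _ (enorm_ge0 z) (enorm_ge0 z) hz hz.
    have := Rle_0_sqr (c * e - (1 + D) * E * M); rewrite /Rsqr /E; lra.
  have -> : dot n z = s * W - de * X by rewrite /z dotBr (dotZr s) (dotZr de).
  have sW : s * W <= c * e * (C2 * E).
    apply: Rle_trans (Rle_abs _) _; rewrite Rabs_mult.
    have : Rabs s * Rabs W <= Rabs s * (C2 * E * om) by apply: Rmult_le_compat_l => //; exact: Rabs_pos.
    have : (Rabs s * om) * (C2 * E) <= c * e * (C2 * E).
      by apply: Rmult_le_compat_r => //; apply: Rmult_le_pos; rewrite /C2; lra.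
    by lra.
  have dX : E * / L <= de * X by apply: Rmult_le_compat; try lra; apply: Rlt_le; apply: Rinv_0_lt_compat.
  have cc : c * c <= rho / (4 * L) by nra.
  have h1 : c * c * E <= rho / (4 * L) * E by apply: Rmult_le_compat_r; lra.
  have h2 : (1 + D) * (1 + D) * (M * M) * (E * E) <= (1 + D) * (1 + D) * (M * M) * (e * E).
    by apply: Rmult_le_compat_l; [do 2?apply: Rmult_le_pos; lra | nra].
  have h3 : c * e * (C2 * E) <= 1 * e * (C2 * E).
    by apply: Rmult_le_compat_r; [apply: Rmult_le_pos; rewrite /C2; lra | nra].
  have h4 : e * K * E < rho / L * E by apply: Rmult_lt_compat_r.
  have h5 : rho * (s * W - de * X) <= rho * (1 * e * (C2 * E) - E * / L) by apply: Rmult_le_compat_l; lra.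
  have h6 : rho / (4 * L) * E = rho / L * E / 4 by field; lra.
  have h7 : rho * (E * / L) = rho / L * E by field; lra.
  have h8 : e * K * E = 2 * ((1 + D) * (1 + D) * (M * M) * (e * E)) + 2 * (rho * (1 * e * (C2 * E))).
    by rewrite /K; ring.
  have h9 : 0 < rho / L * E by apply: Rmult_lt_0_compat.
  by lra.
have [s2 [s20 gs2]] := chord_end hg p w ltac:(lra) nw.
have nw' : vopp w <> vzero.
  by move=> h; apply: nw; have -> : w = vopp (vopp w) by [vring]; rewrite h; vring.
have [s1 [s10]] := chord_end hg p (vopp w) ltac:(lra) nw'.
have -> : vadd p (vscale s1 (vopp w)) = vadd p (vscale (- s1) w) by vring.
move=> gs1.
have far s : g (vadd p (vscale s w)) = 1 -> c * e / om <= Rabs s.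
  move=> gs; case: (Rle_lt_dec (c * e / om) (Rabs s)) => // h.
  have := Rmult_lt_compat_r om _ _ om0 h.
  have -> : c * e / om * om = c * e by field; lra.
  by move=> /Rlt_le /inside; lra.
have f1 := far _ gs1; have f2 := far _ gs2.
rewrite Rabs_Ropp (Rabs_pos_eq s1) in f1; last by lra.
rewrite (Rabs_pos_eq s2) in f2; last by lra.
have sg2 : 2 <= c * e / om.
  by apply: (Rmult_le_reg_r om) => //; have -> : c * e / om * om = c * e by [field; lra]; lra.
exists (cross_log (- s1) s2); split.
  apply/(hdist_gauge hg) => //; try lra.
  exists (- s1), s2; do 2?(split; first lra).
  by do 2?split.
have := cross_log_le (- s1) s2 _ sg2 ltac:(lra) f2.
have -> : 3 / 2 * / (c * e / om) = 3 / 2 / c / e * om by field; lra.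
by [].
Qed.

(** From q at depth of order e^2, travel along the line in the direction that does not decrease n.
    The outer bound kap |z|^2 <= - n.z stops the chord after a length of order e, and one near end
    already makes the distance at least a multiple of |q - p| / e. *)
Lemma sphere_dist_lower x0 r kap : 0 < kap ->
  (forall x, g x = 1 -> enorm (vsub x x0) < r -> exists n, enorm n = 1 /\
     forall y, g y <= 1 -> dot n (vsub y x) <= - kap * dot (vsub y x) (vsub y x)) ->
  exists C, 0 < C /\ forall e p q d, 0 < e <= 1 -> on_sphere e q -> 0 < g q ->
    enorm (vsub (vscale (/ g q) q) x0) < r -> g p < 1 ->
    hdist U (vadd o p) (vadd o q) d -> d <= 1 / 2 -> enorm (vsub q p) <= C * e * d.
Proof.
move=> kap0 hout; set D := L * M.
have D0 : 0 < D by apply: Rmult_lt_0_compat.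
set A := 1 + (1 + D) * M / kap.
have A1 : 1 <= A.
  have : 0 < (1 + D) * M / kap by apply: Rdiv_lt_0_compat => //; nra.
  by rewrite /A; lra.
set B := A + (1 + D) * M.
have B0 : 0 < B by rewrite /B; nra.
exists (6 * B); split; first by lra.
move=> e p q d [e0 e1] sq gq0 hx gp hd hd2.
case: (classic (p = q)) => [pq|npq].
  case: hd => [[_ ->]|[ne _]]; last by case: ne; rewrite pq.
  by rewrite pq; have -> : vsub q q = vzero by [vring]; rewrite enorm_vzero; lra.
have dq := on_sphere_depth e q e0 sq; rewrite -/D in dq.
have E0 : 0 < e * e by nra.
have gq1 : g q < 1 by lra.
move/(hdist_gauge hg p q d npq gp gq1): hd => [s1 [s2 [h1 [h2 [b1 [b2 dE]]]]]].
set x := vscale (/ g q) q in hx *.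
have gx : g x = 1 by apply: radial_bdry.
have qE : q = vscale (g q) x by rewrite /x; vfield; lra.
have xM : enorm x <= M by have := gauge_ge _ _ _ _ _ hg x; rewrite gx; lra.
have [n [n1 hn]] := hout x gx hx.
set w := vsub q p in b1 b2 *; set om := enorm w.
have om0 : 0 <= om by exact: enorm_ge0.
set de := 1 - g q in dq.
have reach tau : g (vadd q (vscale tau w)) = 1 -> 0 <= tau * dot n w -> Rabs tau * om <= B * e.
  move=> gt ht; have := hn _ (Req_le _ _ gt).
  set z := vsub _ x.
  have zE : z = vsub (vscale tau w) (vscale de x).
    rewrite /z {1}qE; apply: functional_extensionality => i.
    by rewrite /vsub /vadd /vscale /de; ring.
  have -> : dot n z = tau * dot n w - de * dot n x by rewrite zE dotBr (dotZr tau) (dotZr de).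
  rewrite -enorm_sqr => hz.
  have Xle : dot n x <= M by have := dot_le_norm n x; rewrite n1; lra.
  have dX : de * dot n x <= (1 + D) * (e * e) * M.
    have : de * dot n x <= de * M by apply: Rmult_le_compat_l; lra.
    by have : de * M <= (1 + D) * (e * e) * M by [apply: Rmult_le_compat_r; lra]; lra.
  have hz2 : enorm z * enorm z <= (A - 1) * (e * e).
    apply: (Rmult_le_reg_l kap) => //.
    have -> : kap * ((A - 1) * (e * e)) = (1 + D) * (e * e) * M by rewrite /A; field; lra.
    by lra.
  have zA : enorm z <= A * e.
    apply: Rsqr_incr_0_var; last by nra.
    rewrite /Rsqr; apply: Rle_trans hz2 _.
    have -> : A * e * (A * e) = A * A * (e * e) by ring.
    by apply: Rmult_le_compat_r; nra.
  rewrite /om -enorm_scale.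
  have -> : vscale tau w = vadd z (vscale de x) by rewrite zE; vring.
  apply: Rle_trans (enormD _ _) _; rewrite (enorm_scale de) (Rabs_pos_eq de); last by lra.
  have : de * enorm x <= (1 + D) * (e * e) * M.
    by apply: Rmult_le_compat; try lra; exact: enorm_ge0.
  have : (1 + D) * M * (e * e) <= (1 + D) * M * e by apply: Rmult_le_compat_l; nra.
  by rewrite /B; lra.
have shift s : vadd p (vscale s w) = vadd q (vscale (s - 1) w) by rewrite /w; vring.
rewrite shift in b1; rewrite shift in b2.
have finish tau : 0 < tau -> s2 - 1 <= tau \/ - s1 <= tau -> tau * om <= B * e -> om <= 6 * B * e * d.
  move=> t0 hts ht.
  have := cross_log_ge s1 s2 tau h1 h2 ltac:(lra) hts t0; rewrite -dE => hi.
  have : B * e * / tau <= B * e * (6 * d) by apply: Rmult_le_compat_l => //; nra.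
  have it : 0 < / tau by apply: Rinv_0_lt_compat.
  have := Rmult_le_compat_r (/ tau) _ _ (Rlt_le _ _ it) ht.
  have -> : tau * om * / tau = om by field; lra.
  by lra.
(* The sign of n.w selects the end of the chord that is certainly near: beyond q if n.w >= 0, beyond
   p otherwise. *)
case: (Rle_lt_dec 0 (dot n w)) => hs.
  apply: (finish (s2 - 1)); try lra.
  by have := reach _ b2 ltac:(nra); rewrite Rabs_pos_eq; lra.
apply: (finish (1 - s1)); try lra.
by have := reach _ b1 ltac:(nra); rewrite Rabs_left; lra.
Qed.

End HilbertSphere.

(** * Covers of a cube *)

Lemma INR_leq (a b : nat) : (a <= b)%nat -> INR a <= INR b.
Proof. by move=> h; apply: le_INR; apply/leP. Qed.

Lemma INR_sum {I : Type} (s : seq I) (f : I -> nat) :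
  INR (\sum_(i <- s) f i)%nat = \big[Rplus/0]_(i <- s) INR (f i).
Proof.
elim: s => [|i s IH]; first by rewrite !big_nil.
by rewrite !big_cons -plusE plus_INR IH.
Qed.

Lemma sum_f_R0_big (f : nat -> R) k : sum_f_R0 f k = \big[Rplus/0]_(i < k.+1) f i.
Proof.
elim: k => [|k IH]; first by rewrite big_ord1.
by rewrite big_ord_recr /= IH.
Qed.

Lemma partial_sum_le (f : nat -> R) s k : (forall i, 0 <= f i) -> infinite_sum f s ->
  \big[Rplus/0]_(i < k) f i <= s.
Proof.
move=> f0 hs.
have h j : \big[Rplus/0]_(i < j.+1) f i <= s by rewrite -sum_f_R0_big; apply: sum_incr.
case: k => [|k]; last exact: h.
by rewrite big_ord0; apply: Rle_trans (h 0%nat); rewrite big_ord1; apply: f0.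
Qed.

(** All indices lie between the least i and the greatest j, so there are at most j - i + 1; h (j -
    i) <= l, and h <= l absorbs the extra one. *)
Lemma spread_card (m : nat) (P : pred 'I_m) h l : 0 < h <= l ->
  (forall i j, P i -> P j -> Rabs (h * INR i - h * INR j) <= l) -> INR #|P| * h <= 2 * l.
Proof.
move=> [h0 hl] hP; case: (pickP P) => [i0 Pi0|P0]; last first.
  by rewrite (eq_card0 P0) /=; lra.
case: (arg_minnP (fun i : 'I_m => nat_of_ord i) Pi0) => i Pi imin.
case: (arg_maxnP (fun i : 'I_m => nat_of_ord i) Pi0) => j Pj jmax.
have ij : (i <= j)%nat := imin j Pj.
have : (#|P| <= (j - i).+1)%nat.
  rewrite cardE -(size_map val) -(size_iota i (j - i).+1).
  apply: uniq_leq_size; first by rewrite map_inj_uniq ?enum_uniq //; exact: val_inj.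
  move=> x /mapP [k]; rewrite mem_enum => Pk ->.
  rewrite mem_iota addnS subnKC //= ltnS.
  by apply/andP; split; [exact: imin | exact: jmax].
move/INR_leq; rewrite S_INR -minusE minus_INR; last exact/leP.
have := Rabs_le_inv _ _ (hP j i Pj Pi).
by move=> [_ ?] ?; nra.
Qed.

(** The [foldr] form is the one in which [card_family] counts functions with prescribed ranges. *)
Lemma foldr_muln_le {I : Type} (s : seq I) (f : I -> nat) c :
  (forall i, INR (f i) <= c) -> INR (foldr muln 1%nat [seq f i | i <- s]) <= c ^ size s.
Proof.
move=> h; elim: s => [|i s IH] /=; first by lra.
rewrite -multE mult_INR.
by apply: Rmult_le_compat => //; apply: pos_INR.
Qed.

Lemma INR_expn (m n : nat) : INR (expn m n) = INR m ^ n.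
Proof. by elim: n => [|n IH] //; rewrite expnS -multE mult_INR IH. Qed.

Lemma pow_add_le x y n : 0 <= x -> 0 <= y -> (x + y) ^ n <= 2 ^ n * (x ^ n + y ^ n).
Proof.
move=> x0 y0; have px := pow_le x n x0; have py := pow_le y n y0.
have p2 : 0 < 2 ^ n by apply: pow_lt; lra.
have h z : 0 <= z -> x + y <= 2 * z -> (x + y) ^ n <= 2 ^ n * z ^ n.
  by move=> z0 hz; rewrite -Rpow_mult_distr; apply: pow_incr; lra.
by case: (Rle_lt_dec x y) => xy; [have := h y y0 | have := h x x0] => /(_ ltac:(lra)); nra.
Qed.

Section Cover.
Context {n : nat}.
Implicit Types (E : nat -> pt n -> Prop) (z : pt n).

Definition in_cube (eta : R) z : Prop := forall j, 0 <= z j <= eta.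
Definition cdiam_le (A : pt n -> Prop) (a : R) : Prop :=
  forall z z', A z -> A z' -> forall j, Rabs (z j - z' j) <= a.

(* A set of coordinate diameter [b] contains at most [(2 b / h)^n] points of a
   grid of mesh [h <= b]. *)
Lemma finite_cover_sum (k : nat) E (b : nat -> R) eta : 0 < eta ->
  (forall i, 0 < b i) -> (forall i, cdiam_le (E i) (b i)) ->
  (forall z, in_cube eta z -> exists i : 'I_k, E i z) ->
  eta ^ n <= \big[Rplus/0]_(i < k) (2 * b i) ^ n.
Proof.
move=> eta0 b0 hE hcov.
have q0 i : 0 <= eta / b i by apply: Rlt_le; apply: Rdiv_lt_0_compat.
(* Exceeding the sum of all eta / b_i makes the mesh eta / m at most every b_i; the 1 makes m
   positive. *)
have [m hm] := INR_unbounded (1 + \big[Rplus/0]_(i < k) (eta / b i)).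
have S0 : 0 <= \big[Rplus/0]_(i < k) (eta / b i) by apply: bigR_ge0.
have m0 : 0 < INR m by lra.
set h := eta / INR m.
have h0 : 0 < h by apply: Rdiv_lt_0_compat.
have hb (i : 'I_k) : h <= b i.
  have := bigR_ge_term (fun i : 'I_k => eta / b i) i (fun j => q0 j) => hi.
  have hlt : eta / b i <= INR m by lra.
  apply: (Rmult_le_reg_r (INR m)) => //; rewrite /h.
  have -> : eta / INR m * INR m = eta by field; lra.
  have := Rmult_le_compat_l (b i) _ _ (Rlt_le _ _ (b0 i)) hlt.
  by have -> : b i * (eta / b i) = eta by [field; have := b0 i; lra].
pose zf (f : {ffun 'I_n -> 'I_m}) : pt n := fun j => h * INR (f j).
have zf_in f : in_cube eta (zf f).
  move=> j; split; first by apply: Rmult_le_pos; [lra | apply: pos_INR].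
  have : INR (f j) <= INR m by apply: INR_leq; apply: ltnW.
  move=> /(Rmult_le_compat_l h _ _ (Rlt_le _ _ h0)).
  by have -> : h * INR m = eta by rewrite /h; field; lra.
pose D (i : 'I_k) (f : {ffun 'I_n -> 'I_m}) : bool :=
  if excluded_middle_informative (E i (zf f)) then true else false.
have DP i f : D i f -> E i (zf f) by rewrite /D; case: excluded_middle_informative.
have Dex f : exists i, D i f.
  have [i Ei] := hcov _ (zf_in f); exists i.
  by rewrite /D; case: excluded_middle_informative.
have count : (expn m n <= \sum_(i < k) #|D i|)%nat.
  have -> : (expn m n) = (\sum_(f : {ffun 'I_n -> 'I_m}) 1)%nat.
    by rewrite sum1_card card_ffun !card_ord.
  have -> : (\sum_(i < k) #|D i|)%nat = (\sum_(i < k) \sum_(f : {ffun 'I_n -> 'I_m}) D i f)%nat.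
    by apply: eq_bigr => i _; rewrite -sum1_card big_mkcond; apply: eq_bigr => f _;
       rewrite -topredE /=; case: (D i f).
  rewrite exchange_big; apply: leq_sum => f _.
  have [i Di] := Dex f; rewrite (bigD1 i) //= Di.
  by rewrite leq_addr.
(* The grid points in E_i form a subset of the product of their coordinate projections, each of
   spread at most b_i. *)
have cardD (i : 'I_k) : INR #|D i| <= (2 * b i / h) ^ n.
  pose P (j : 'I_n) : pred 'I_m := fun v => [exists f, D i f && (f j == v)].
  have PC j : INR #|P j| <= 2 * b i / h.
    apply: (Rmult_le_reg_r h) => //.
    have -> : 2 * b i / h * h = 2 * b i by field; lra.
    apply: spread_card; first by split.
    move=> v v' /existsP [f /andP [Df /eqP <-]] /existsP [f' /andP [Df' /eqP <-]].
    exact: (hE i (zf f) (zf f') (DP _ _ Df) (DP _ _ Df') j).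
  have sub : (#|D i| <= #|finfun.family P|)%nat.
    apply: subset_leq_card; apply/subsetP => f Df; apply/familyP => j.
    by rewrite unfold_in; apply/existsP; exists f; rewrite eqxx andbT.
  apply: Rle_trans (INR_leq _ _ sub) _.
  rewrite card_family.
  have := foldr_muln_le (enum 'I_n) (fun j => #|P j|) _ PC.
  by rewrite size_enum_ord.
have main : INR m ^ n <= \big[Rplus/0]_(i < k) (2 * b i / h) ^ n.
  rewrite -INR_expn; apply: Rle_trans (INR_leq _ _ count) _.
  rewrite INR_sum; apply: bigR_le => i; exact: cardD.
have hn : 0 < h ^ n by apply: pow_lt.
have := Rmult_le_compat_l (h ^ n) _ _ (Rlt_le _ _ hn) main.
rewrite -Rpow_mult_distr; have -> : h * INR m = eta by rewrite /h; field; lra.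
move=> hh; apply: Rle_trans hh _; right; rewrite -bigR_scale; apply: eq_bigr => i _.
by rewrite -Rpow_mult_distr; congr (_ ^ _); field; lra.
Qed.

(** The covering sets need not be open and may have diameter 0, so each is thickened by a summable
    amount. A point outside the first k thickened sets for every k would produce a cluster point in
    some E_i, hence points in its thickening. *)
Lemma cube_cover_sum E (a : nat -> R) eta s : (1 <= n)%nat -> 0 < eta ->
  (forall i, 0 <= a i) -> (forall i, cdiam_le (E i) (a i)) ->
  (forall z, in_cube eta z -> exists i, E i z) ->
  infinite_sum (fun i => a i ^ n) s -> eta ^ n <= 4 ^ n * s.
Proof.
move=> n1 eta0 a0 hE hcov hs.
have p4 : 0 < 4 ^ n by apply: pow_lt; lra.
suff main eps : 0 < eps <= 1 -> eta ^ n <= 4 ^ n * (s + 2 * eps).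
  apply: (le_epsilon_mul _ _ (4 ^ n * 3)); first by lra.
  move=> eps heps; have := main (Rmin eps 1) ltac:(split; [apply: Rmin_pos; lra | exact: Rmin_r]).
  by have := Rmin_l eps 1; have := Rmult_lt_0_compat _ _ p4 heps; nra.
move=> [eps0 eps1].
(* The thickenings sum to less than 2 eps, and ga i <= 1 gives ga i ^ n <= ga i because n >= 1. *)
pose ga (i : nat) := eps * (/ 2) ^ i.
have ga0 i : 0 < ga i by apply: Rmult_lt_0_compat => //; apply: pow_lt; lra.
have ga1 i : ga i <= 1.
  have : (/ 2) ^ i <= 1 by rewrite -(pow1 i); apply: pow_incr; lra.
  by have : 0 < (/ 2) ^ i by [apply: pow_lt; lra]; rewrite /ga; nra.
pose E' i z := exists z', E i z' /\ forall j, Rabs (z j - z' j) < ga i / 2.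
pose b i := a i + ga i.
have b0 i : 0 < b i by have := a0 i; have := ga0 i; rewrite /b; lra.
have hE' i : cdiam_le (E' i) (b i).
  move=> y z [y' [hy yy]] [z' [hz zz]] j.
  have := Rabs_le_inv _ _ (hE i y' z' hy hz j).
  have := Rabs_le_inv _ _ (Rlt_le _ _ (yy j)); have := Rabs_le_inv _ _ (Rlt_le _ _ (zz j)).
  by move=> *; apply: Rabs_le; rewrite /b; lra.
have [k hk] : exists k : nat, forall z, in_cube eta z -> exists i : 'I_k, E' i z.
  apply: NNPP => hn.
  have bad (k : nat) : exists z, in_cube eta z /\ forall i : 'I_k, ~ E' i z.
    apply: NNPP => hk; apply: hn; exists k => z hz.
    by apply: NNPP => hi; apply: hk; exists z; split=> // i Ei; apply: hi; exists i.
  pose z k := proj1_sig (constructive_indefinite_description _ (bad k)).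
  have hz k : in_cube eta (z k) /\ forall i : 'I_k, ~ E' i (z k).
    exact: proj2_sig (constructive_indefinite_description _ (bad k)).
  have zB k : enorm (z k) <= INR n * eta.
    apply: enorm_le_coords; first by lra.
    by move=> j; apply: Rabs_le; have := proj1 (hz k) j; lra.
  have [l hl] := bounded_cluster z _ zB.
  have lin : in_cube eta l.
    move=> j; split; apply: (le_epsilon_mul _ _ 1); try lra; move=> e e0;
      have [k [_ hk]] := hl (e / 2) ltac:(lra) 0%nat; have := proj1 (hz k) j;
      have := Rabs_le_inv _ _ (Rle_trans _ _ _ (coord_le (vsub (z k) l) j) (Rlt_le _ _ hk));
      by rewrite /vsub; lra.
  have [i Ei] := hcov l lin.
  have [k [ik hk]] := hl (ga i / 2) ltac:(have := ga0 i; lra) i.+1.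
  have ik' : (i < k)%nat by apply/leP.
  apply: (proj2 (hz k) (Ordinal ik')); exists l; split=> // j.
  exact: Rle_lt_trans (coord_le (vsub (z k) l) j) hk.
apply: Rle_trans (finite_cover_sum k E' b eta eta0 b0 hE' hk) _.
have term i : (2 * b i) ^ n <= 4 ^ n * (a i ^ n + ga i).
  have -> : 4 = 2 * 2 by ring.
  rewrite !Rpow_mult_distr Rmult_assoc; apply: Rmult_le_compat_l; first by apply: pow_le; lra.
  apply: Rle_trans (pow_add_le _ _ _ (a0 i) (Rlt_le _ _ (ga0 i))) _.
  apply: Rmult_le_compat_l; first by apply: pow_le; lra.
  apply: Rplus_le_compat_l.
  case: n n1 => // n' _ /=.
  have : ga i ^ n' <= 1 by rewrite -(pow1 n'); apply: pow_incr; have := ga0 i; have := ga1 i; lra.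
  by have := ga0 i; nra.
apply: Rle_trans (bigR_le _ _ _ (fun i : 'I_k => term i)) _.
rewrite bigR_scale; apply: Rmult_le_compat_l; first by lra.
rewrite big_split; apply: Rplus_le_compat.
  by apply: (partial_sum_le (fun i => a i ^ n)) => // i; apply: pow_le.
suff : \big[Rplus/0]_(i < k) ga i = 2 * eps * (1 - (/ 2) ^ k).
  by move=> ->; have : 0 < (/ 2) ^ k by [apply: pow_lt; lra]; nra.
elim: (k) => [|j IH]; first by rewrite big_ord0 /=; ring.
by rewrite big_ord_recr /= IH /ga; field.
Qed.

End Cover.

(** * Nets on Hilbert spheres *)

(** One Lipschitz estimate for radial projections: a and b are values of [gauge2] when projecting to
    the sphere, and of g when projecting to the boundary. *)
Lemma scale_lip {N} (u v : pt N) a b m K B : 0 < m <= a -> m <= b ->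
  Rabs (a - b) <= K * enorm (vsub u v) -> enorm v <= B ->
  enorm (vsub (vscale (/ a) u) (vscale (/ b) v)) <= (/ m + B * K * (/ m * / m)) * enorm (vsub u v).
Proof.
move=> [m0 ma] mb hab hv.
have -> : vsub (vscale (/ a) u) (vscale (/ b) v) =
    vadd (vscale (/ a) (vsub u v)) (vscale ((b - a) * (/ a * / b)) v).
  by vfield; lra.
have im : 0 < / m by apply: Rinv_0_lt_compat.
have ia : 0 < / a <= / m by split; [apply: Rinv_0_lt_compat; lra | apply: Rinv_le_contravar; lra].
have ib : 0 < / b <= / m by split; [apply: Rinv_0_lt_compat; lra | apply: Rinv_le_contravar; lra].
apply: Rle_trans (enormD _ _) _.
rewrite (enorm_scale (/ a)) (enorm_scale ((b - a) * _)) Rabs_mult Rabs_minus_sym.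
rewrite (Rabs_pos_eq (/ a)) ?(Rabs_pos_eq (/ a * / b)); try nra.
set d := enorm (vsub u v) in hab *; have d0 : 0 <= d by exact: enorm_ge0.
have h1 : / a * d <= / m * d by apply: Rmult_le_compat_r; lra.
have h2 : / a * / b <= / m * / m by apply: Rmult_le_compat; lra.
have h3 : Rabs (a - b) * (/ a * / b) <= K * d * (/ m * / m).
  by apply: Rmult_le_compat => //; [exact: Rabs_pos | nra].
have h4 : Rabs (a - b) * (/ a * / b) * enorm v <= K * d * (/ m * / m) * B.
  apply: Rmult_le_compat => //; last exact: enorm_ge0.
  by apply: Rmult_le_pos; [exact: Rabs_pos | nra].
by lra.
Qed.

Lemma max_coord {k : nat} (f : 'I_k.+1 -> R) : exists i, forall j, f j <= f i.
Proof.
suff [i hi] : exists i, forall j, j \in enum 'I_k.+1 -> f j <= f i.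
  by exists i => j; apply: hi; rewrite mem_enum.
elim: (enum _) => [|j s [i hi]]; first by exists ord0.
case: (Rle_lt_dec (f j) (f i)) => h; [exists i | exists j] => l; rewrite inE => /orP [/eqP ->|ls] //.
- exact: hi.
- by lra.
- by have := hi l ls; lra.
Qed.

Lemma nearest_ord (m : nat) x : 0 <= x <= INR m -> exists k : 'I_m.+1, Rabs (x - INR k) <= 1.
Proof.
elim: m => [|m IH] hx.
  by exists ord0; rewrite /= in hx *; apply: Rabs_le; lra.
case: (Rle_lt_dec x (INR m)) => h.
  have [k hk] := IH ltac:(lra); exists (widen_ord (leqnSn _) k) => //.
exists ord_max; rewrite S_INR in hx; apply: Rabs_le.
by rewrite -[nat_of_ord _]/(m.+1) S_INR; lra.
Qed.

Lemma infinite_sum_finite (f : nat -> R) k : (forall i, (k <= i)%nat -> f i = 0) ->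
  infinite_sum f (\big[Rplus/0]_(i < k) f i).
Proof.
move=> h eps e0; exists k => j /leP jk.
suff -> : sum_f_R0 f j = \big[Rplus/0]_(i < k) f i.
  by rewrite /Rdist Rminus_diag Rabs_R0.
rewrite sum_f_R0_big; move: jk; rewrite leq_eqVlt => /orP [/eqP <-|jk].
  by rewrite big_ord_recr /= h ?Rplus_0_r.
have -> : j.+1 = (k + (j.+1 - k))%nat by rewrite subnKC //; apply: leqW; apply: ltnW.
by rewrite big_split_ord /= [X in _ + X]big1 ?Rplus_0_r // => i _; apply: h; rewrite leq_addr.
Qed.

Lemma infinite_sum_scal (f : nat -> R) c s : infinite_sum f s ->
  infinite_sum (fun i => c * f i) (c * s).
Proof.
move=> hs.
have h1 : Un_cv (fun _ => c) c.
  by move=> e e0; exists 0%nat => i _; rewrite /Rdist Rminus_diag Rabs_R0.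
move=> e e0; have [K hK] := CV_mult _ _ _ _ h1 hs e e0; exists K => i iK.
have := hK i iK; suff -> : sum_f_R0 (fun i => c * f i) i = c * sum_f_R0 f i by [].
by elim: (i) => [|j IH] //=; rewrite IH; ring.
Qed.

Section Geometry.
Context {n : nat} {U : pt n.+1 -> Prop} {o : pt n.+1} {g : pt n.+1 -> R} {L M : R}.
Hypothesis Uopen : is_open U.
Hypothesis Ubounded : is_bounded U.
Hypothesis Ubdry : C3_pos_curv_boundary U.
Hypothesis hg : is_gauge U o g L M.

Let L0 : 0 < L := gauge_L _ _ _ _ _ hg.
Let M0 : 0 < M := gauge_M _ _ _ _ _ hg.
Let gZ := gauge_scale _ _ _ _ _ hg.

Lemma gauge_inner_ball : exists rho, 0 < rho /\
  forall x, g x = 1 -> inner_ball (fun y => g y < 1) x rho.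
Proof.
have [rho [r0 hr]] := inner_ball_uniform Uopen Ubounded Ubdry.
exists rho; split=> // x /(gauge_bdry _ _ _ _ _ hg) /hr [v [v1 hv]].
exists v; split=> // y hy; apply/(gauge_in _ _ _ _ _ hg); apply: hv.
by have -> : vsub (vadd o y) (vadd o x) = vsub y x by vring.
Qed.

(** Convexity makes the local estimate global: any y in the body is contracted towards x until it
    enters the neighbourhood of x0. The linear term scales by tau and the quadratic one by tau^2, so
    the estimate survives with kap tau. *)
Lemma gauge_outer_ball x0 : g x0 = 1 -> exists r kap, 0 < r /\ 0 < kap /\
  forall x, g x = 1 -> enorm (vsub x x0) < r -> exists v, enorm v = 1 /\
    forall y, g y <= 1 -> dot v (vsub y x) <= - kap * dot (vsub y x) (vsub y x).
Proof.
move=> /(gauge_bdry _ _ _ _ _ hg) /(outer_ball_local Ubdry) [d [kap [d0 [k0 hd]]]].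
have sh (a b : pt n.+1) : vsub (vadd o a) (vadd o b) = vsub a b by vring.
(* As |y - x| <= 2 M, the contracted displacement is shorter than d/2, the room left by |x - x0| <
   d/2. *)
set tau := d / (4 * M + 2 * d).
have t0 : 0 < tau by apply: Rdiv_lt_0_compat; lra.
have tE : tau * (4 * M + 2 * d) = d by rewrite /tau; field; lra.
exists (d / 2), (kap * tau); split; first by lra.
split; first by apply: Rmult_lt_0_compat.
move=> x gx hx.
have [v [v1 hv]] := hd (vadd o x) (proj2 (gauge_bdry _ _ _ _ _ hg _) gx) ltac:(rewrite sh; lra).
exists v; split=> // y gy.
set w := vsub y x; set y' := vadd x (vscale tau w).
have gy' : g y' <= 1.
  have := gauge_convex hg x y tau ltac:(nra); rewrite -/w -/y' gx; nra.
have wM : enorm w <= 2 * M.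
  apply: Rle_trans (enormB _ _) _.
  have := gauge_ge _ _ _ _ _ hg x; have := gauge_ge _ _ _ _ _ hg y.
  by rewrite gx; nra.
have near : enorm (vsub (vadd o y') (vadd o x0)) < d.
  rewrite sh; have -> : vsub y' x0 = vadd (vsub x x0) (vscale tau w) by rewrite /y'; vring.
  apply: Rle_lt_trans (enormD _ _) _; rewrite (enorm_scale tau) Rabs_pos_eq; last by lra.
  by have := enorm_ge0 w; nra.
have mem : U (vadd o y') \/ bdry U (vadd o y').
  case: (Rle_lt_or_eq_dec _ _ gy') => h; first by left; apply/(gauge_in _ _ _ _ _ hg).
  by right; apply/(gauge_bdry _ _ _ _ _ hg).
have := hv _ mem near; rewrite sh.
have -> : vsub y' x = vscale tau w by rewrite /y'; vring.
rewrite (dotZr tau) (dotZr tau) (dotZl tau) => h.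
by apply: (Rmult_le_reg_l tau) => //; lra.
Qed.

(** The sphere is the level set [gauge2] = 1 - e^2 of this positively homogeneous function, and
    [sphere_point] is the radial projection onto it. *)
Definition gauge2 (e : R) (u : pt n.+1) : R := g u + e * e * g (vopp u).
Definition sphere_point (e : R) (u : pt n.+1) : pt n.+1 :=
  vscale ((1 - e * e) * / gauge2 e u) u.

Lemma gauge2_scale e c u : 0 <= c -> gauge2 e (vscale c u) = c * gauge2 e u.
Proof.
move=> c0; rewrite /gauge2 (gZ c u c0).
have -> : vopp (vscale c u) = vscale c (vopp u) by vring.
by rewrite (gZ c (vopp u) c0); ring.
Qed.

Lemma gauge2_ge e u : g u <= gauge2 e u.
Proof. by rewrite /gauge2; have := gauge_ge0 hg (vopp u); nra. Qed.

Lemma gauge2_le e u : 0 < e < 1 -> gauge2 e u <= 2 * L * enorm u.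
Proof.
move=> he; have := gauge_le _ _ _ _ _ hg u; have := gauge_le _ _ _ _ _ hg (vopp u).
rewrite {2}/vopp (enorm_scale (-1)) Rabs_Ropp Rabs_R1 /gauge2.
by have := gauge_ge0 hg (vopp u); have : e * e <= 1 by [nra]; nra.
Qed.

Lemma gauge2_lip e u v : 0 < e < 1 ->
  Rabs (gauge2 e u - gauge2 e v) <= 2 * L * enorm (vsub u v).
Proof.
move=> he; have := Rabs_le_inv _ _ (gauge_lip hg u v).
have := Rabs_le_inv _ _ (gauge_lip hg (vopp u) (vopp v)).
have -> : vsub (vopp u) (vopp v) = vsub v u by vring.
rewrite (enorm_subC v u) /gauge2 => h1 h2.
have e2 : 0 < e * e < 1 by nra.
have Ld : 0 <= L * enorm (vsub u v) by apply: Rmult_le_pos; [lra | exact: enorm_ge0].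
by apply: Rabs_le; nra.
Qed.

Lemma on_sphere_point e u : 0 < e < 1 -> 0 < gauge2 e u -> on_sphere (g := g) e (sphere_point e u).
Proof.
move=> he hu; change (gauge2 e (sphere_point e u) = 1 - e * e).
rewrite gauge2_scale; first by field; lra.
by apply: Rmult_le_pos; [nra | apply: Rlt_le; apply: Rinv_0_lt_compat].
Qed.

(** The boundary of the cube [-1, 1]^(n+1) serves as the space of directions: its faces are n-cubes,
    on which regular grids give nets. *)
Definition box_unit (u : pt n.+1) : Prop := (forall j, Rabs (u j) <= 1) /\ exists i, Rabs (u i) = 1.

Lemma box_unit_ge1 u : box_unit u -> 1 <= enorm u.
Proof. by move=> [_ [i <-]]; apply: coord_le. Qed.

Lemma box_unit_le u : box_unit u -> enorm u <= INR n.+1.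
Proof. by move=> [h _]; rewrite -[INR _]Rmult_1_r; apply: enorm_le_coords => //; lra. Qed.

Lemma box_unit_gauge u : box_unit u -> / M <= g u.
Proof.
move=> /box_unit_ge1 hu; apply: (Rmult_le_reg_l M) => //.
by rewrite Rinv_r; [have := gauge_ge _ _ _ _ _ hg u; lra | lra].
Qed.

(** The constant precedes e: the bounds 1/M from below and 2 L for the Lipschitz constant of
    [gauge2] hold for all e below 1, so one grid has the same mesh order on all spheres. *)
Lemma sphere_point_lip : exists C, 0 < C /\ forall e u v, 0 < e < 1 -> box_unit u -> box_unit v ->
  enorm (vsub (sphere_point e u) (sphere_point e v)) <= C * enorm (vsub u v).
Proof.
set C := / / M + INR n.+1 * (2 * L) * (/ / M * / / M).
have C0 : 0 < C.
  rewrite /C Rinv_inv; have : 0 <= INR n.+1 by exact: pos_INR.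
  move=> ?; have : 0 <= INR n.+1 * (2 * L) * (M * M) by do 2?apply: Rmult_le_pos; nra.
  by lra.
exists C; split=> // e u v he bu bv.
have iM : 0 < / M by apply: Rinv_0_lt_compat.
have := @scale_lip _ u v (gauge2 e u) (gauge2 e v) (/ M) (2 * L) (INR n.+1)
  (conj iM (Rle_trans _ _ _ (box_unit_gauge u bu) (gauge2_ge e u)))
  (Rle_trans _ _ _ (box_unit_gauge v bv) (gauge2_ge e v)) (gauge2_lip e u v he) (box_unit_le v bv).
rewrite -/C.
have -> : vsub (sphere_point e u) (sphere_point e v) =
    vscale (1 - e * e) (vsub (vscale (/ gauge2 e u) u) (vscale (/ gauge2 e v) v)).
  by rewrite /sphere_point; vring.
rewrite (enorm_scale (1 - e * e)) Rabs_pos_eq; last by nra.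
set d := enorm (vsub (vscale _ _) _); have : 0 <= d by exact: enorm_ge0.
by have : 0 < e * e < 1 by [nra]; nra.
Qed.

(** A face of the cube, given by the fixed coordinate and its sign, together with a grid position in
    the n free coordinates. *)
Definition net_index (m : nat) : finType := ('I_n.+1 * bool * {ffun 'I_n -> 'I_m.+1})%type.
Definition net_dir {m : nat} (t : net_index m) : pt n.+1 := fun j =>
  if unlift t.1.1 j is Some j' then -1 + 2 * INR (t.2 j') / INR m else if t.1.2 then 1 else -1.

Lemma net_dir_box m (t : net_index m) : (0 < m)%nat -> box_unit (net_dir t).
Proof.
move=> /ltP /lt_0_INR m0; split.
  move=> j; rewrite /net_dir; case: unlift => [j'|]; last first.
    by case: ifP => _; rewrite ?Rabs_Ropp Rabs_R1; lra.
  have h : INR (t.2 j') <= INR m by apply: INR_leq; rewrite -ltnS.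
  have h0 := pos_INR (t.2 j').
  have : 0 <= INR (t.2 j') / INR m <= 1.
    split; first by apply: Rmult_le_pos => //; apply: Rlt_le; apply: Rinv_0_lt_compat.
    by apply: (Rmult_le_reg_r (INR m)) => //; rewrite /Rdiv Rmult_assoc Rinv_l; lra.
  by move=> hq; apply: Rabs_le; rewrite /Rdiv in hq *; lra.
exists t.1.1; rewrite /net_dir unlift_none.
by case: ifP => _; rewrite ?Rabs_Ropp Rabs_R1.
Qed.

Lemma net_dir_near m u : (0 < m)%nat -> box_unit u ->
  exists t : net_index m, enorm (vsub u (net_dir t)) <= INR n.+1 * (2 / INR m).
Proof.
move=> /ltP /lt_0_INR m0 [hu [i hi]].
have hk (j : 'I_n) : exists k : 'I_m.+1, Rabs ((u (lift i j) + 1) * INR m / 2 - INR k) <= 1.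
  by apply: nearest_ord; have := Rabs_le_inv _ _ (hu (lift i j)); nra.
pose f := [ffun j => proj1_sig (constructive_indefinite_description _ (hk j))].
have hf j : Rabs ((u (lift i j) + 1) * INR m / 2 - INR (f j)) <= 1.
  by rewrite ffunE; case: constructive_indefinite_description.
have im : 0 < / INR m by apply: Rinv_0_lt_compat.
exists (i, (if Rlt_le_dec (u i) 0 then false else true), f).
apply: enorm_le_coords; first by rewrite /Rdiv; lra.
move=> j; rewrite /vsub /net_dir /=; case: unliftP => [j' ->|->].
  have -> : u (lift i j') - (-1 + 2 * INR (f j') / INR m) =
    2 / INR m * ((u (lift i j') + 1) * INR m / 2 - INR (f j')) by field; lra.
  rewrite Rabs_mult Rabs_pos_eq; last by rewrite /Rdiv; lra.
  by have := hf j'; rewrite /Rdiv; nra.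
have d0 : 0 <= 2 / INR m by rewrite /Rdiv; lra.
move: hi; rewrite {1}/Rabs; case: Rcase_abs => h hi; case: Rlt_le_dec => h' //; try lra.
  by have -> : u i - -1 = 0 by [lra]; rewrite Rabs_R0.
by have -> : u i - 1 = 0 by [lra]; rewrite Rabs_R0.
Qed.

Lemma sphere_net : exists C, 0 < C /\ forall e m, 0 < e < 1 -> (0 < m)%nat ->
  exists x : net_index m -> pt n.+1, (forall t, on_sphere (g := g) e (x t)) /\
    forall y, on_sphere (g := g) e y -> exists t, enorm (vsub y (x t)) <= C / INR m.
Proof.
have [C [C0 hC]] := sphere_point_lip.
exists (C * (INR n.+1 * 2)); split.
  by do 2?apply: Rmult_lt_0_compat; try lra; apply: lt_0_INR; apply/ltP.
move=> e m he m0.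
have pos u : box_unit u -> 0 < gauge2 e u.
  move=> /box_unit_gauge hu; have := gauge2_ge e u.
  by have : 0 < / M by [apply: Rinv_0_lt_compat]; lra.
exists (fun t => sphere_point e (net_dir t)); split.
  by move=> t; apply: on_sphere_point => //; apply: pos; apply: net_dir_box.
move=> y ys.
have [i hi] := max_coord (fun j => Rabs (y j)).
have y0 : y <> vzero.
  move=> yz; move: ys; rewrite /on_sphere yz.
  have -> : vopp (@vzero n.+1) = vzero by vring.
  by rewrite (gauge_vzero hg); nra.
have yi : 0 < Rabs (y i).
  case: (Rle_lt_or_eq_dec _ _ (Rabs_pos (y i))) => // z; case: y0.
  apply: functional_extensionality => j; have := hi j; rewrite -z.
  by have := Rabs_pos (y j); rewrite /vzero /Rabs; case: Rcase_abs; lra.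
set c := Rabs (y i) in hi yi.
have ic : 0 < / c by apply: Rinv_0_lt_compat.
set u := vscale (/ c) y.
have bu : box_unit u.
  split=> [j|]; last by exists i; rewrite /u /vscale Rabs_mult (Rabs_pos_eq (/ c)) ?Rinv_l; lra.
  rewrite /u /vscale Rabs_mult (Rabs_pos_eq (/ c)); last by lra.
  by apply: (Rmult_le_reg_l c) => //; rewrite -Rmult_assoc Rinv_r; have := hi j; lra.
have yE : y = sphere_point e u.
  have G1 : gauge2 e y = 1 - e * e by exact: ys.
  rewrite /sphere_point /u gauge2_scale ?G1; last by lra.
  by vfield; nra.
have [t ht] := net_dir_near m u m0 bu.
exists t; rewrite yE; apply: Rle_trans (hC e u (net_dir t) he bu (net_dir_box m t m0)) _.
have := Rmult_le_compat_l C _ _ (Rlt_le _ _ C0) ht.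
by rewrite /Rdiv; lra.
Qed.

End Geometry.

(** * Hausdorff measure of Hilbert spheres *)

Section AdmissibleSums.
Context {n : nat} {U : pt n.+1 -> Prop} {o : pt n.+1} {g : pt n.+1 -> R} {L M : R}.
Hypothesis n1 : (1 <= n)%nat.
Hypothesis Uopen : is_open U.
Hypothesis Ubounded : is_bounded U.
Hypothesis Ubdry : C3_pos_curv_boundary U.
Hypothesis hg : is_gauge U o g L M.

Let L0 : 0 < L := gauge_L _ _ _ _ _ hg.
Let M0 : 0 < M := gauge_M _ _ _ _ _ hg.

Lemma card_net_index m : #|@net_index n m| = (n.+1 * 2 * expn m.+1 n)%nat.
Proof. by rewrite /net_index !card_prod card_ord card_bool card_ffun !card_ord. Qed.

(** A net of 2 (n + 1) (m + 1)^n points with Hilbert radius of order 1/(e m) has a sum in which m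
    cancels, up to m + 1 <= 2 m; hence one bound serves every mesh r. *)
Lemma adm_sums_upper : exists C e0, 0 < C /\ 0 < e0 /\
  forall t, 0 < t -> exp (- t) < e0 -> forall r, 0 < r ->
    exists s, adm_sums U n (hsphere U o t) r s /\ s <= C / exp (- t) ^ n.
Proof.
have [rho [r0 hball]] := gauge_inner_ball Uopen Ubounded Ubdry hg.
have [C1 [e0 [C10 [e00 hup]]]] := sphere_dist_upper hg rho r0 hball.
have [C2 [C20 hnet]] := sphere_net hg.
exists (INR n.+1 * 2 * (2 * (C1 * C2)) ^ n), e0; split.
  do 2?apply: Rmult_lt_0_compat; try lra; first by apply: lt_0_INR; apply/ltP.
  by apply: pow_lt; do 2?apply: Rmult_lt_0_compat; lra.
split=> // t t0; set e := exp (- t) => he0 r hr.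
have he : 0 < e < 1 by split; [exact: exp_pos | rewrite -exp_0; apply: exp_increasing; lra].
have [h [h0 hd]] := hup e ltac:(lra).
(* The three terms make m at least 1, the Euclidean mesh smaller than the threshold h, and twice the
   Hilbert radius smaller than r. *)
have [m hm] := INR_unbounded (1 + C2 / h + 2 * (C1 / e * C2) / r).
have q1 : 0 < C2 / h by apply: Rdiv_lt_0_compat.
have Ce : 0 < C1 / e by apply: Rdiv_lt_0_compat; lra.
have q2 : 0 < 2 * (C1 / e * C2) / r.
  by apply: Rdiv_lt_0_compat => //; do 2?apply: Rmult_lt_0_compat; lra.
have m1 : (0 < m)%nat by apply/ltP; apply: INR_lt; rewrite /=; lra.
have mp : 0 < INR m by lra.
have mh : C2 / INR m < h.
  apply: (Rmult_lt_reg_r (INR m)) => //; have -> : C2 / INR m * INR m = C2 by field; lra.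
  have : C2 / h < INR m by lra.
  move=> /(Rmult_lt_compat_l h _ _ h0).
  by have -> : h * (C2 / h) = C2 by field; lra.
set rad := C1 / e * (C2 / INR m).
have rad0 : 0 < rad by apply: Rmult_lt_0_compat => //; apply: Rdiv_lt_0_compat.
have radr : 2 * rad < r.
  have : 2 * (C1 / e * C2) / r < INR m by lra.
  move=> /(Rmult_lt_compat_l (r / INR m) _ _ (Rdiv_lt_0_compat _ _ hr mp)).
  have -> : r / INR m * INR m = r by field; lra.
  by have -> : r / INR m * (2 * (C1 / e * C2) / r) = 2 * rad by rewrite /rad; field; lra.
have [x [xs hx]] := hnet e m he m1.
pose t00 : @net_index n m := (ord0, true, [ffun=> ord0] : {ffun 'I_n -> 'I_m.+1}).
pose xi (i : nat) := nth t00 (enum (@net_index n m)) i.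
set K := #|@net_index n m|.
exists (\big[Rplus/0]_(i < K) rad ^ n); split; last first.
  rewrite bigR_ord_const /K card_net_index -!multE !mult_INR INR_expn.
  have -> : INR 2 = 2 by rewrite /=; ring.
  have hm1 : INR m.+1 * rad <= 2 * (C1 * C2) * / e.
    have -> : 2 * (C1 * C2) * / e = 2 * INR m * rad by rewrite /rad; field; lra.
    apply: Rmult_le_compat_r; first by lra.
    rewrite S_INR; have := INR_leq _ _ m1; rewrite -[INR 1]/1; lra.
  have hp : (INR m.+1 * rad) ^ n <= (2 * (C1 * C2) * / e) ^ n.
    by apply: pow_incr; split=> //; apply: Rmult_le_pos; [exact: pos_INR | lra].
  rewrite (Rpow_mult_distr (INR m.+1)) (Rpow_mult_distr (2 * (C1 * C2))) pow_inv in hp.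
  have -> : INR n.+1 * 2 * INR m.+1 ^ n * rad ^ n = INR n.+1 * 2 * (INR m.+1 ^ n * rad ^ n) by ring.
  rewrite /Rdiv [X in _ <= X]Rmult_assoc; apply: Rmult_le_compat_l.
    by apply: Rmult_le_pos; [exact: pos_INR | lra].
  exact: hp.
(* Beyond index K, [nth] returns the default [t00], still a centre on the sphere as required; the
   radius 0 then contributes 0 ^ n = 0, by n >= 1. *)
exists (fun i => vadd o (x (xi i))), (fun i => if (i < K)%nat then rad else 0).
split; first by move=> i; case: ifP => _; lra.
split; first by move=> i; apply/(hsphere_gauge hg).
split; last first.
  have hsum := infinite_sum_finite (fun i => (if (i < K)%nat then rad else 0) ^ n) K.
  have -> : \big[Rplus/0]_(i < K) rad ^ n =
    \big[Rplus/0]_(i < K) (if (i < K)%nat then rad else 0) ^ n.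
    by apply: eq_bigr => i _; rewrite ltn_ord.
  apply: hsum => i; rewrite leqNgt => /negbTE ->.
  by rewrite pow_i //; apply/ltP.
move=> y0; have -> : y0 = vadd o (vsub y0 o) by vring.
set y := vsub y0 o => hy.
have ys : on_sphere (g := g) e y by apply/(hsphere_gauge hg).
have [k hk] := hx y ys.
exists (index k (enum (@net_index n m))).
have kin : k \in enum (@net_index n m) by rewrite mem_enum.
have -> : (index k (enum (@net_index n m)) < K)%nat by rewrite /K cardE index_mem.
rewrite /xi nth_index //; split; first by case: hy.
have key : C1 / e * enorm (vsub y (x k)) <= rad by apply: Rmult_le_compat_l; lra.
case: (classic (x k = y)) => [->|ne].
  by exists 0; split; [left | lra].
have [d [hdd dle]] := hd (x k) y (xs k) ys ne ltac:(lra).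
by exists d; split=> //; lra.
Qed.

(** The face of the cube where coordinate 0 equals 1, parametrized by the other coordinates;
    [sphere_point] carries it to a patch of the sphere. *)
Definition patch_dir (z : pt n) : pt n.+1 := fun j => if unlift ord0 j is Some j' then z j' else 1.

Lemma patch_dir_lift z j : patch_dir z (lift ord0 j) = z j.
Proof. by rewrite /patch_dir liftK. Qed.

Lemma patch_dir_ord0 z : patch_dir z ord0 = 1.
Proof. by rewrite /patch_dir unlift_none. Qed.

Lemma patch_dir_box eta z : 0 < eta <= 1 -> in_cube eta z -> box_unit (patch_dir z).
Proof.
move=> he hz; split; last by exists ord0; rewrite patch_dir_ord0 Rabs_R1.
move=> j; case: (unliftP ord0 j) => [j' ->|->]; last by rewrite patch_dir_ord0 Rabs_R1; lra.
by rewrite patch_dir_lift; apply: Rabs_le; have := hz j'; lra.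
Qed.

(** A Hilbert ball of radius rho_i meets the patch in a set of Euclidean diameter of order e rho_i,
    and central projection to the face enlarges this only by a constant. The condition r <= 1 keeps
    radii below 1/2, where the distance comparison holds. *)
Lemma adm_sums_lower : exists c e0, 0 < c /\ 0 < e0 /\
  forall t, 0 < t -> exp (- t) < e0 -> forall r s, r <= 1 ->
    adm_sums U n (hsphere U o t) r s -> c / exp (- t) ^ n <= s.
Proof.
have iM : 0 < / M by apply: Rinv_0_lt_compat.
have N0 : 0 < INR n.+1 by apply: lt_0_INR; apply/ltP.
pose z0 : pt n := vzero.
have z0in : in_cube 1 z0 by move=> j; rewrite /z0 /vzero; lra.
have bz0 := patch_dir_box 1 z0 ltac:(lra) z0in.
set u0 := patch_dir z0 in bz0.
have gpos u : box_unit u -> 0 < g u by move=> /(box_unit_gauge hg); lra.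
set x0 := vscale (/ g u0) u0.
have gx0 : g x0 = 1 by apply: (radial_bdry hg); apply: gpos.
have [r0 [kap [r00 [kap0 hout]]]] := gauge_outer_ball Ubdry hg x0 gx0.
have [C [C0 hlow]] := sphere_dist_lower hg x0 r0 kap kap0 hout.
set B := / / M + INR n.+1 * L * (/ / M * / / M).
have B0 : 0 < B.
  rewrite /B Rinv_inv; have : 0 < INR n.+1 * L * (M * M) by do 2?apply: Rmult_lt_0_compat; nra.
  by lra.
(* The cube is so small that the whole patch projects radially to boundary points within r0 of x0,
   where the outer estimate holds; B is the Lipschitz constant of that projection. *)
set eta := Rmin 1 (r0 / (2 * (B * INR n.+1))).
have BN : 0 < B * INR n.+1 by apply: Rmult_lt_0_compat.
have eta0 : 0 < eta by apply: Rmin_pos; [lra | apply: Rdiv_lt_0_compat; lra].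
have eta1 : eta <= 1 by apply: Rmin_l.
have etar : B * (INR n.+1 * eta) < r0.
  have := Rmult_le_compat_l (B * INR n.+1) _ _ (Rlt_le _ _ BN) (Rmin_r 1 (r0 / (2 * (B * INR n.+1)))).
  rewrite -/eta; have -> : B * INR n.+1 * (r0 / (2 * (B * INR n.+1))) = r0 / 2 by field; lra.
  by lra.
(* A lower bound for the radial factor (1 - e^2) / gauge2, from e < 1/2 and gauge2 <= 2 L (n + 1) on
   the cube boundary. *)
set c1 := / (4 * L * INR n.+1).
have LN : 0 < 4 * L * INR n.+1 by apply: Rmult_lt_0_compat; lra.
have c10 : 0 < c1 by apply: Rinv_0_lt_compat.
set K := 4 * C / c1.
have K0 : 0 < K by apply: Rdiv_lt_0_compat; lra.
have p4 : 0 < 4 ^ n by apply: pow_lt; lra.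
exists (eta ^ n / (4 ^ n * K ^ n)), (1 / 2); split.
  apply: Rdiv_lt_0_compat; first exact: pow_lt.
  by apply: Rmult_lt_0_compat => //; apply: pow_lt.
split; first by lra.
move=> t t0; set e := exp (- t) => he2 r s r1 [x [rho [hrho [hx [hcov hsum]]]]].
have he : 0 < e < 1 by split; [exact: exp_pos | lra].
pose P z := sphere_point (g := g) e (patch_dir z).
have dir_near z : in_cube eta z -> enorm (vsub (patch_dir z) u0) <= INR n.+1 * eta.
  move=> hz; apply: enorm_le_coords; first by lra.
  move=> j; rewrite /vsub /u0; case: (unliftP ord0 j) => [j' ->|->].
    by rewrite !patch_dir_lift /z0 /vzero; apply: Rabs_le; have := hz j'; lra.
  by rewrite !patch_dir_ord0 Rminus_diag Rabs_R0; lra.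
have Pdata z : in_cube eta z -> exists al, c1 <= al /\ P z = vscale al (patch_dir z) /\
    on_sphere (g := g) e (P z) /\ 0 < g (P z) /\
    enorm (vsub (vscale (/ g (P z)) (P z)) x0) < r0.
  move=> hz; have bz := patch_dir_box eta z ltac:(lra) hz.
  set u := patch_dir z in bz *.
  have gu := gpos u bz.
  have G0 : 0 < gauge2 (g := g) e u by have := gauge2_ge hg e u; lra.
  have e2 : e * e <= 1 / 2 by nra.
  set al := (1 - e * e) * / gauge2 (g := g) e u.
  have al0 : 0 < al by apply: Rmult_lt_0_compat; [lra | apply: Rinv_0_lt_compat].
  have gP : g (P z) = al * g u by rewrite /P /sphere_point (gauge_scale _ _ _ _ _ hg) -/al //; lra.
  exists al; split.
    have G1 : gauge2 (g := g) e u <= 2 * L * INR n.+1.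
      apply: Rle_trans (gauge2_le hg e u he) _.
      by apply: Rmult_le_compat_l; [lra | exact: box_unit_le].
    apply: (Rmult_le_reg_r (gauge2 (g := g) e u)) => //.
    have -> : al * gauge2 (g := g) e u = 1 - e * e by rewrite /al; field; lra.
    have := Rmult_le_compat_l c1 _ _ (Rlt_le _ _ c10) G1.
    have -> : c1 * (2 * L * INR n.+1) = 1 / 2 by rewrite /c1; field; lra.
    by lra.
  split=> //; split; first exact: (on_sphere_point hg).
  rewrite gP; split; first by apply: Rmult_lt_0_compat.
  have -> : vscale (/ (al * g u)) (P z) = vscale (/ g u) u.
    by rewrite /P /sphere_point -/u -/al; vfield; lra.
  apply: Rle_lt_trans etar.
  have gm v : box_unit v -> / M <= g v by exact: box_unit_gauge hg v.
  apply: Rle_trans (@scale_lip _ u u0 (g u) (g u0) (/ M) L (INR n.+1)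
    (conj iM (gm u bz)) (gm u0 bz0) (gauge_lip hg u u0) (box_unit_le u0 bz0)) _.
  by apply: Rmult_le_compat_l; [rewrite -/B; lra | exact: dir_near].
pose E i z := in_cube eta z /\ hball U (x i) (rho i) (vadd o (P z)).
have near i z : E i z -> enorm (vsub (P z) (vsub (x i) o)) <= C * e * rho i.
  move=> [hz [_ [d [hd dr]]]].
  have [al [_ [_ [sP [gP hP]]]]] := Pdata z hz.
  have hri := hrho i.
  have xE : x i = vadd o (vsub (x i) o) by vring.
  have gp : g (vsub (x i) o) < 1.
    by apply/(gauge_in _ _ _ _ _ hg); rewrite -xE; case: (hx i).
  rewrite xE in hd.
  have := hlow e (vsub (x i) o) (P z) d ltac:(lra) sP gP hP gp hd ltac:(lra).
  have : C * e * d <= C * e * rho i by apply: Rmult_le_compat_l => //; nra.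
  by lra.
have hE i : cdiam_le (E i) (K * e * rho i).
  move=> z z' Ez Ez' j.
  have [al [hal [PE _]]] := Pdata z (proj1 Ez).
  have [al' [hal' [PE' _]]] := Pdata z' (proj1 Ez').
  have dist : enorm (vsub (P z) (P z')) <= 2 * (C * e * rho i).
    apply: Rle_trans (enorm_triangle (vsub (x i) o) _ _) _.
    by have := near i z Ez; have := near i z' Ez'; rewrite (enorm_subC (P z')); lra.
  (* Since coordinate 0 of [patch_dir] is 1, this coordinate compares the radial factors al and al'
     directly; the others then bound z - z', as al (z j - z' j) is a coordinate difference plus z' j
     (al' - al). *)
  have h0 := Rle_trans _ _ _ (coord_le (vsub (P z) (P z')) ord0) dist.
  have hj := Rle_trans _ _ _ (coord_le (vsub (P z) (P z')) (lift ord0 j)) dist.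
  move: h0 hj; rewrite PE PE' /vsub /vscale !patch_dir_ord0 !patch_dir_lift !Rmult_1_r.
  set D := 2 * (C * e * rho i) => h0 hj.
  have z1 := proj1 Ez' j.
  have D0 : 0 <= D by apply: Rle_trans h0; exact: Rabs_pos.
  have -> : K * e * rho i = 2 * D / c1 by rewrite /K /D; field; lra.
  apply: (Rmult_le_reg_l al); first by lra.
  have e1 : al * (z j - z' j) = (al * z j - al' * z' j) + z' j * (al' - al) by ring.
  have -> : al * Rabs (z j - z' j) = Rabs (al * (z j - z' j)).
    by rewrite Rabs_mult (Rabs_pos_eq al) //; lra.
  rewrite e1.
  have : Rabs (al * z j - al' * z' j + z' j * (al' - al)) <= 2 * D.
    apply: Rle_trans (Rabs_triang _ _) _.
    have : Rabs (z' j * (al' - al)) <= 1 * D.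
      rewrite Rabs_mult Rabs_minus_sym; apply: Rmult_le_compat; try exact: Rabs_pos => //.
        by apply: Rabs_le; lra.
      by [].
    by lra.
  have : c1 * (2 * D / c1) <= al * (2 * D / c1).
    by apply: Rmult_le_compat_r => //; apply: Rmult_le_pos; [lra | apply: Rlt_le; apply: Rinv_0_lt_compat].
  have -> : c1 * (2 * D / c1) = 2 * D by field; lra.
  by lra.
have Ecov z : in_cube eta z -> exists i, E i z.
  move=> hz; have [al [_ [_ [sP _]]]] := Pdata z hz.
  have [i hi] := hcov (vadd o (P z)) (proj2 (hsphere_gauge hg t (P z) t0) sP).
  by exists i.
have hs : infinite_sum (fun i => (K * e * rho i) ^ n) ((K * e) ^ n * s).
  have -> : (fun i => (K * e * rho i) ^ n) = (fun i => (K * e) ^ n * rho i ^ n).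
    by apply: functional_extensionality => i; rewrite -Rpow_mult_distr.
  exact: infinite_sum_scal.
have a0 i : 0 <= K * e * rho i by have := hrho i => hri; apply: Rmult_le_pos; nra.
have := cube_cover_sum E (fun i => K * e * rho i) eta _ n1 eta0 a0 hE Ecov hs.
have en : 0 < e ^ n by apply: pow_lt; lra.
have kn : 0 < K ^ n by apply: pow_lt.
rewrite Rpow_mult_distr => main.
apply: (Rmult_le_reg_l (4 ^ n * (K ^ n * e ^ n))).
  by do 2?apply: Rmult_lt_0_compat.
have -> : 4 ^ n * (K ^ n * e ^ n) * (eta ^ n / (4 ^ n * K ^ n) / e ^ n) = eta ^ n by field; lra.
by lra.
Qed.

End AdmissibleSums.

(** * Existence of the measure and its exponential growth rate *)

Lemma unit_ball_vol_gt0 k : 0 < unit_ball_vol k.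
Proof.
suff [] : 0 < unit_ball_vol k /\ 0 < unit_ball_vol k.+1 by [].
elim: k => [|k [h1 h2]]; first by rewrite /=; lra.
split=> //; rewrite -[unit_ball_vol k.+2]/(2 * PI / INR k.+2 * unit_ball_vol k).
apply: Rmult_lt_0_compat => //; apply: Rdiv_lt_0_compat; first by have := PI_RGT_0; lra.
by apply: lt_0_INR; apply/ltP.
Qed.

(* The infima increase as the mesh [r] decreases, so they converge to their supremum. *)
Lemma hmeasure_exists {N} (U : pt N -> Prop) k (A : pt N -> Prop) a b :
  (forall r, 0 < r -> exists s, adm_sums U k A r s /\ s <= b) ->
  (forall r s, r <= 1 -> adm_sums U k A r s -> a <= s) ->
  exists v, hmeasure U k A (unit_ball_vol k * v) /\ a <= v <= b.
Proof.
move=> hup hlow.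
have ge0 r s : adm_sums U k A r s -> 0 <= s.
  move=> [x [rho [hr [_ [_ hs]]]]].
  have := partial_sum_le _ s 0 (fun i => pow_le _ k (proj1 (hr i))) hs.
  by rewrite big_ord0.
have infx r : 0 < r -> exists I, is_inf (adm_sums U k A r) I.
  move=> r0; apply: (is_inf_exists _ 0); last exact: ge0.
  by have [s [hs _]] := hup r r0; exists s.
have mono r r' s : r <= r' -> adm_sums U k A r s -> adm_sums U k A r' s.
  move=> rr [x [rho [hr h]]]; exists x, rho; split=> // i.
  by have := hr i; lra.
pose S I := exists r, 0 < r /\ is_inf (adm_sums U k A r) I.
have Sb I : S I -> I <= b.
  move=> [r [r0 [hI _]]]; have [s [hs sb]] := hup r r0.
  by have := hI s hs; lra.
have [v [vub vlub]] : {v | is_lub S v}.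
  apply: completeness; first by exists b => I /Sb.
  by have [I hI] := infx 1 ltac:(lra); exists I, 1; split=> //; lra.
exists v; split; last first.
  split; last by apply: vlub => I /Sb.
  have [I hI] := infx 1 ltac:(lra).
  have : I <= v by apply: vub; exists 1; split=> //; lra.
  have : a <= I by apply: (proj2 hI) => s; apply: hlow; lra.
  by lra.
have w0 := unit_ball_vol_gt0 k.
move=> eps e0; set d := eps / unit_ball_vol k.
have d0 : 0 < d by apply: Rdiv_lt_0_compat.
(* An infimum within d of the supremum v at one mesh r0; by monotonicity every smaller mesh keeps
   its infimum between I0 and v. *)
have [r0 [I0 [r00 [hI0 hv]]]] : exists r0 I0, 0 < r0 /\ is_inf (adm_sums U k A r0) I0 /\ v - d < I0.
  apply: NNPP => hn; suff : v <= v - d by lra.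
  apply: vlub => I [r [r0 hI]]; case: (Rle_lt_dec I (v - d)) => // h.
  by case: hn; exists r, I.
exists r0; split=> // r [rp rr].
have [I hI] := infx r rp; exists I; split=> //.
have h1 : I <= v by apply: vub; exists r.
have h2 : I0 <= I.
  by apply: (proj2 hI) => s hs; apply: (proj1 hI0); apply: mono hs; lra.
have -> : unit_ball_vol k * I - unit_ball_vol k * v = unit_ball_vol k * (I - v) by ring.
rewrite Rabs_mult Rabs_pos_eq; last by lra.
have -> : eps = unit_ball_vol k * d by rewrite /d; field; lra.
by apply: Rmult_lt_compat_l => //; apply: Rabs_def1; lra.
Qed.

Lemma ln_le x y : 0 < x -> x <= y -> ln x <= ln y.
Proof. by move=> x0 [h|->]; [apply/Rlt_le/ln_increasing | right]. Qed.

Lemma div_exp_opp_pow c t n : c / exp (- t) ^ n = c * exp (INR n * t).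
Proof.
have h : exp (- t) ^ n * exp (INR n * t) = 1.
  elim: n => [|n IH]; first by rewrite /= Rmult_0_l exp_0; ring.
  rewrite S_INR Rmult_plus_distr_r exp_plus Rmult_1_l /=.
  have : exp (- t) * exp t = 1 by rewrite -exp_plus Rplus_opp_l exp_0.
  by move: IH; nra.
have p : 0 < exp (- t) ^ n by apply: pow_lt; exact: exp_pos.
by rewrite -[c in c / _]Rmult_1_r -h; field; lra.
Qed.

Theorem theorem1 (n : nat) (U : pt n.+1 -> Prop) (o : pt n.+1) :
  (1 <= n)%nat ->
  is_open U -> is_bounded U -> is_convex U ->
  C3_pos_curv_boundary U ->
  U o ->
  exists (V : R -> R) (T0 : R),
    (forall t, T0 < t -> hmeasure U n (hsphere U o t) (V t) /\ 0 < V t) /\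
    (forall eps, 0 < eps -> exists T, forall t, T < t ->
       Rabs (ln (V t) / t - INR n) < eps).
Proof.
move=> n1 Uopen Ubounded Uconvex Ubdry Uo.
have [g [L [M hg]]] := gauge_exists U o Uopen Ubounded Uconvex Uo.
have [C [e1 [C0 [e10 hup]]]] := adm_sums_upper n1 Uopen Ubounded Ubdry hg.
have [c [e2 [c0 [e20 hlow]]]] := adm_sums_lower n1 Ubdry hg.
set e := Rmin e1 e2.
have e0 : 0 < e by apply: Rmin_pos.
set T0 := Rmax 0 (- ln e).
have small t : T0 < t -> 0 < t /\ exp (- t) < e1 /\ exp (- t) < e2.
  move=> ht; have h1 := Rle_lt_trans _ _ _ (Rmax_l _ _) ht.
  have h2 := Rle_lt_trans _ _ _ (Rmax_r _ _) ht.
  have : exp (- t) < e by rewrite -[e]exp_ln //; apply: exp_increasing; lra.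
  by have := Rmin_l e1 e2; have := Rmin_r e1 e2; rewrite -/e; lra.
have w0 := unit_ball_vol_gt0 n; set w := unit_ball_vol n in w0.
have ex t : exists V, T0 < t -> hmeasure U n (hsphere U o t) V /\
    w * c * exp (INR n * t) <= V <= w * C * exp (INR n * t).
  (* For t <= T0 nothing is claimed, and 0 is an arbitrary value making the choice function
     total. *)
  case: (Rle_lt_dec t T0) => ht; first by exists 0; lra.
  have [t0 [h1 h2]] := small t ht.
  have [v [hv [vc vC]]] := hmeasure_exists U n (hsphere U o t) _ _ (hup t t0 h1) (hlow t t0 h2).
  rewrite !div_exp_opp_pow in vc vC.
  by exists (w * v) => _; split=> //; rewrite !Rmult_assoc; split; apply: Rmult_le_compat_l; lra.
pose V t := proj1_sig (constructive_indefinite_description _ (ex t)).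
have hV t : T0 < t -> hmeasure U n (hsphere U o t) (V t) /\
    w * c * exp (INR n * t) <= V t <= w * C * exp (INR n * t).
  exact: proj2_sig (constructive_indefinite_description _ (ex t)).
have wc : 0 < w * c by apply: Rmult_lt_0_compat.
have wC : 0 < w * C by apply: Rmult_lt_0_compat.
exists V, T0; split.
  move=> t ht; have [hm [hl _]] := hV t ht; split=> //.
  by have := Rmult_lt_0_compat _ _ wc (exp_pos (INR n * t)); lra.
(* Taking logarithms of the two exponential bounds places ln (V t) - n t between ln (w c) and ln (w
   C), hence within B of 0; t > B / eps makes the quotient small. *)
move=> eps heps; set B := Rabs (ln (w * c)) + Rabs (ln (w * C)).
have B0 : 0 <= B by have := Rabs_pos (ln (w * c)); have := Rabs_pos (ln (w * C)); rewrite /B; lra.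
exists (Rmax T0 (B / eps)) => t ht.
have hT := Rle_lt_trans _ _ _ (Rmax_l _ _) ht.
have hB := Rle_lt_trans _ _ _ (Rmax_r _ _) ht.
have [t0 _] := small t hT; have [_ [hl hu]] := hV t hT.
have p1 := Rmult_lt_0_compat _ _ wc (exp_pos (INR n * t)).
have p2 := Rmult_lt_0_compat _ _ wC (exp_pos (INR n * t)).
have l1 := ln_le _ _ p1 hl.
have l2 := ln_le _ _ (Rlt_le_trans _ _ _ p1 hl) hu.
rewrite ln_mult ?ln_exp in l1; try lra; try exact: exp_pos.
rewrite ln_mult ?ln_exp in l2; try lra; try exact: exp_pos.
have -> : ln (V t) / t - INR n = (ln (V t) - INR n * t) / t by field; lra.
rewrite /Rdiv Rabs_mult (Rabs_pos_eq (/ t)); last by apply: Rlt_le; apply: Rinv_0_lt_compat.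
apply: (Rmult_lt_reg_r t) => //; rewrite Rmult_assoc Rinv_l ?Rmult_1_r; last by lra.
have : B < eps * t.
  have := Rmult_lt_compat_l eps _ _ heps hB.
  by have -> : eps * (B / eps) = B by field; lra.
have := Rabs_le_inv _ _ (Rle_refl (Rabs (ln (w * c)))).
have := Rabs_le_inv _ _ (Rle_refl (Rabs (ln (w * C)))).
rewrite /B => ? ? ?; apply: Rle_lt_trans (_ : B < _); last by rewrite /B.
apply: Rabs_le; rewrite /B.
have := Rabs_pos (ln (w * c)); have := Rabs_pos (ln (w * C)); lra.
Qed.
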